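(* Let $\mathcal{G}$ be a second-countable, locally compact, étale groupoid such that $\mathcal{G}^{(0)}$ is Hausdorff, $\mathcal{G}$ is effective, and for every nonzero $a\in C^*_r(\mathcal{G})$ the set $\operatorname{supp}(j(a))$ has nonempty interior in $\mathcal{G}$. Let $B$ be a $C^*$-algebra and let $\rho:C^*_r(\mathcal{G})\to B$ be a $C^*$-homomorphism that is injective on $C_0(\mathcal{G}^{(0)})$. Then $\rho$ is injective.
   Context: Groupoids $\mathcal{G}$ are topological groupoids with unit space $\mathcal{G}^{(0)}$ and range and source maps $r,s$, not necessarily Hausdorff. An open bisection is an open set $U\subseteq\mathcal{G}$ such that $r$ and $s$ each restrict to a homeomorphism of $U$ onto an open subset of $\mathcal{G}^{(0)}$. $\mathcal{G}$ is étale if its topology has a basis of open bisections. $\operatorname{Iso}(\mathcal{G})=\{\gamma: r(\gamma)=s(\gamma)\}$, and $\mathcal{G}$ is effective if the interior of $\operatorname{Iso}(\mathcal{G})$ equals $\mathcal{G}^{(0)}$. $\mathcal{C}(\mathcal{G})$ is the complex linear span, inside the functions $\mathcal{G}\to\mathbb{C}$, of the spaces $C_c(U)$ for open bisections $U\subseteq\mathcal{G}$, where an element of $C_c(U)$ (a continuous function on $U$ vanishing outside a compact subset of $U$) is extended by $0$ to $\mathcal{G}$. It is a $*$-algebra with $f*g(\gamma)=\sum_{r(\eta)=r(\gamma)}f(\eta)g(\eta^{-1}\gamma)$ and $f^*(\gamma)=\overline{f(\gamma^{-1})}$. For $u\in\mathcal{G}^{(0)}$ let $\mathcal{G}_u=s^{-1}(u)$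 and let $L_u:\mathcal{C}(\mathcal{G})\to\mathcal{B}(\ell^2(\mathcal{G}_u))$ be the representation $L_u(f)\delta_\gamma=\sum_{\alpha\in\mathcal{G}_{r(\gamma)}}f(\alpha)\delta_{\alpha\gamma}$. $C^*_r(\mathcal{G})$ is the completion of the image of $\mathcal{C}(\mathcal{G})$ under $\bigoplus_{u}L_u$; each $L_u$ extends to it. For $a\in C^*_r(\mathcal{G})$ define $j(a):\mathcal{G}\to\mathbb{C}$ by $j(a)(\gamma)=(L_{s(\gamma)}(a)\delta_{s(\gamma)}\mid\delta_\gamma)$; the map $j$ is injective, linear, norm-decreasing into bounded functions with $\|\cdot\|_\infty$, and $j(f)=f$ for $f\in\mathcal{C}(\mathcal{G})$. For a function $h$, $\operatorname{supp}(h)=\{\gamma: h(\gamma)\ne0\}$ (no closure). $C_0(\mathcal{G}^{(0)})$ is regarded as a $C^*$-subalgebra of $C^*_r(\mathcal{G})$ via the extension of the inclusion $C_c(\mathcal{G}^{(0)})\subseteq\mathcal{C}(\mathcal{G})$ (extension of functions by $0$). *)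

(* Defs.v *)
From HB Require Import structures.
From mathcomp Require Import all_boot all_order all_algebra.
From mathcomp Require Import all_classical all_reals all_analysis.
From mathcomp Require Import ring lra complex.
From mathcomp.analysis.showcase Require summability.

Set Implicit Arguments.
Unset Strict Implicit.
Unset Printing Implicit Defensive.

Import Order.TTheory GRing.Theory Num.Theory.
Import numFieldNormedType.Exports.

Local Open Scope classical_set_scope.
Local Open Scope ring_scope.

(* The complex numbers with the topology of the modulus, as a normed space over
   themselves. *)
HB.instance Definition _ (R : realType) := NormedModule.copy R[i] R[i]^o.

(* The algebra need not be unital, so it cannot be one of the MathComp rings. *)
HB.mixin Record CompleteNormedModule_isCStarAlgebra (R : realType) B
    of CompleteNormedModule R[i] B := {
  cmul : B -> B -> B;
  cstar : B -> B;
  cmulA : associative cmul;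
  cmulDl : left_distributive cmul +%R;
  cmulDr : right_distributive cmul +%R;
  cmulZl : forall (c : R[i]) (x y : B), cmul (c *: x) y = c *: cmul x y;
  cmulZr : forall (c : R[i]) (x y : B), cmul x (c *: y) = c *: cmul x y;
  cstarK : involutive cstar;
  cstarD : {morph cstar : x y / x + y};
  cstarZ : forall (c : R[i]) (x : B), cstar (c *: x) = Num.conj c *: cstar x;
  cstarM : forall x y : B, cstar (cmul x y) = cmul (cstar y) (cstar x);
  cnormM : forall x y : B, `|cmul x y| <= `|x| * `|y|;
  cnorm_star : forall x : B, `|cmul (cstar x) x| = `|x| ^+ 2
}.

#[short(type="cstarAlgType")]
HB.structure Definition CStarAlgebra (R : realType) :=
  { B of CompleteNormedModule R[i] B
       & CompleteNormedModule_isCStarAlgebra R B }.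

(* [gmul a b] is the product ab of a composable pair, i.e. [gsrc a = grng b];
   its values on the other pairs are irrelevant. The unit space is a space of
   its own, and [gunit] embeds it in the groupoid: [gunit] is a homeomorphism
   onto its range, since it is continuous with continuous left inverse. *)
Record topGroupoid := TopGroupoid {
  garrow :> topologicalType;
  gunits : topologicalType;
  grng : garrow -> gunits;
  gsrc : garrow -> gunits;
  gunit : gunits -> garrow;
  ginv : garrow -> garrow;
  gmul : garrow -> garrow -> garrow;
  grng_unit : forall u, grng (gunit u) = u;
  gsrc_unit : forall u, gsrc (gunit u) = u;
  grngM : forall a b, gsrc a = grng b -> grng (gmul a b) = grng a;
  gsrcM : forall a b, gsrc a = grng b -> gsrc (gmul a b) = gsrc b;
  gmulA : forall a b c, gsrc a = grng b -> gsrc b = grng c ->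
    gmul a (gmul b c) = gmul (gmul a b) c;
  gmul1g : forall a, gmul (gunit (grng a)) a = a;
  gmulg1 : forall a, gmul a (gunit (gsrc a)) = a;
  grngV : forall a, grng (ginv a) = gsrc a;
  gsrcV : forall a, gsrc (ginv a) = grng a;
  gmulVg : forall a, gmul (ginv a) a = gunit (gsrc a);
  gmulgV : forall a, gmul a (ginv a) = gunit (grng a);
  grng_continuous : continuous grng;
  gsrc_continuous : continuous gsrc;
  gunit_continuous : continuous gunit;
  ginv_continuous : continuous ginv;
  gmul_continuous :
    {within [set p : garrow * garrow | gsrc p.1 = grng p.2],
      continuous (fun p : garrow * garrow => gmul p.1 p.2)}
}.

Definition homeo_onto_open (X Y : topologicalType) (U : set X) (f : X -> Y) :=
  [/\ open (f @` U), {within U, continuous f} &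
      exists g : Y -> X, {within f @` U, continuous g} /\ {in U, cancel f g}].

Definition open_bisection (G : topGroupoid) (U : set G) :=
  [/\ open U, homeo_onto_open U (@grng G) & homeo_onto_open U (@gsrc G)].

Definition etale (G : topGroupoid) :=
  exists2 B : set (set G), basis B & B `<=` @open_bisection G.

Definition giso (G : topGroupoid) : set G := [set a | grng a = gsrc a].

Definition effective (G : topGroupoid) := (@giso G)° = range (@gunit G).

(* [locally_compact] of the library asks for closed compact neighbourhoods,
   which is too strong for spaces that are not Hausdorff. *)
Definition has_compact_nbhs (X : topologicalType) :=
  forall x : X, exists2 K : set X, nbhs x K & compact K.

(* C_c(U), each function being extended by 0 outside U. *)
Definition Cc (R : realType) (X : topologicalType) (U : set X)
    (f : X -> R[i]) :=
  {within U, continuous f} /\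
  exists K, [/\ K `<=` U, compact K & forall x, ~ K x -> f x = 0].

Definition CG (R : realType) (G : topGroupoid) (f : G -> R[i]) :=
  exists n (c : 'I_n -> R[i]) (g : 'I_n -> G -> R[i]),
    (forall i, exists2 U, open_bisection U & Cc U (g i)) /\
    f = fun a => \sum_(i < n) c i * g i a.

Definition normsq (R : realType) (z : R[i]) : R :=
  complex.Re z ^+ 2 + complex.Im z ^+ 2.

Section normsq.
Context {R : realType}.
Implicit Types z w : R[i].

Lemma normsq_ge0 z : 0 <= normsq z.
Proof. by rewrite addr_ge0 ?sqr_ge0. Qed.

Lemma normsqE z : (normsq z)%:C%C = `|z| ^+ 2.
Proof. by rewrite normc_def -rmorphXn sqr_sqrtr ?normsq_ge0. Qed.

Lemma normsqD z w : normsq (z + w) <= 2 * normsq z + 2 * normsq w.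
Proof.
case: z w => [a b] [c d]; rewrite /normsq /=.
by have := sqr_ge0 (a - c); have := sqr_ge0 (b - d); lra.
Qed.

Lemma normsqM z w : normsq (z * w) = normsq z * normsq w.
Proof. by case: z w => [a b] [c d]; rewrite /normsq /=; ring. Qed.

End normsq.

Section square_summable.
Context (R : realType) (X : choiceType).
Implicit Types x y : X -> R[i].

Definition sqsum x : \bar R := (\esum_(i in [set: X]) (normsq (x i))%:E)%E.

Definition sqsummable : {pred (X -> R[i])} := [pred x | (sqsum x < +oo)%E].

Lemma sqsumD x y : (sqsum (x + y)%R <= 2%:E * sqsum x + 2%:E * sqsum y)%E.
Proof.
apply: ge_ereal_sup => _ [A [finA _] <-].
have sum_le z : (\sum_(i \in A) (normsq (z i))%:E <= sqsum z)%E.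
  by apply: ereal_sup_ubound; exists A.
apply: (@le_trans _ _ (2%:E * (\sum_(i \in A) (normsq (x i))%:E) +
                       2%:E * (\sum_(i \in A) (normsq (y i))%:E))%E).
  rewrite !ge0_mule_fsumr//; do ?by move=> i; rewrite lee_fin normsq_ge0.
  rewrite -fsbig_split//= lee_fsum// => i Ai.
  by rewrite -!EFinM -EFinD lee_fin normsqD.
by apply: leeD; apply: lee_wpmul2l => //; rewrite lee_fin.
Qed.

Lemma sqsumZ (c : R[i]) x : (sqsum (c *: x)%R <= (normsq c)%:E * sqsum x)%E.
Proof.
apply: ge_ereal_sup => _ [A [finA _] <-].
apply: (@le_trans _ _ ((normsq c)%:E * (\sum_(i \in A) (normsq (x i))%:E))%E).
  rewrite ge0_mule_fsumr//; last by move=> i; rewrite lee_fin normsq_ge0.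
  by apply: lee_fsum => // i Ai; rewrite -EFinM lee_fin -normsqM.
apply: lee_wpmul2l; first by rewrite lee_fin normsq_ge0.
by apply: ereal_sup_ubound; exists A.
Qed.

Lemma sqsum_ge0 x : (0 <= sqsum x)%E.
Proof. by apply: esum_ge0 => i _; rewrite lee_fin normsq_ge0. Qed.

Lemma sqsummable_submod_closed : submod_closed sqsummable.
Proof.
split=> [|c x y]; rewrite !inE.
  rewrite /sqsum esum1// => i _; congr (_%:E).
  by rewrite /normsq /= expr0n addr0.
move=> sx sy; apply: le_lt_trans (sqsumD _ _) _.
have fin2 z : (sqsum z < +oo)%E -> (2%:E * sqsum z < +oo)%E.
  by move=> sz; rewrite lte_mul_pinfty.
apply: lte_add_pinfty; apply: fin2 => //.
apply: le_lt_trans (sqsumZ _ _) _.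
by rewrite lte_mul_pinfty ?lee_fin ?normsq_ge0.
Qed.

HB.instance Definition _ := GRing.isSubmodClosed.Build _ _ sqsummable
  sqsummable_submod_closed.

End square_summable.

Section ell2.
Context (R : realType) (X : choiceType).

Record ell2 := Ell2 { ell2_fun :> X -> R[i]; _ : ell2_fun \in @sqsummable R X }.

HB.instance Definition _ := [isSub for ell2_fun].
HB.instance Definition _ := [Choice of ell2 by <:].
HB.instance Definition _ := [SubChoice_isSubLmodule of ell2 by <:].

Definition delta_fun (i : X) : X -> R[i] := fun k => (k == i)%:R.

Lemma delta_subproof (i : X) : delta_fun i \in @sqsummable R X.
Proof.
rewrite inE /sqsum (esumID [set i]) => [|k _]; last by rewrite lee_fin normsq_ge0.
rewrite setTI esum_set1 ?lee_fin ?normsq_ge0// esum1 ?adde0 ?ltry// => k [_ /=].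
move=> /eqP/negbTE ki; rewrite /delta_fun ki; congr (_%:E).
by rewrite /normsq /= expr0n addr0.
Qed.

Definition delta (i : X) : ell2 := Ell2 (delta_subproof i).

Definition ell2_norm (x : ell2) : R := Num.sqrt (fine (sqsum x)).

(* The sum is the limit over the finite subsets of [X], in the complex numbers. *)
Definition ell2_dot (x y : ell2) : R[i] :=
  summability.sum (fun i => x i * Num.conj (y i)).

End ell2.

(* Families (T_u)_u of operators on the spaces l^2(G_u), u in the unit space.
    The uniformly bounded families are the elements of the l^oo-direct sum of
    the algebras B(l^2(G_u)), which is where the direct sum of the regular
    representations takes its values. *)

Section operators.
Context (R : realType) (G : topGroupoid).

Definition fiber (u : gunits G) := {a : G | gsrc a == u}.

Definition opfam := forall u : gunits G, ell2 R (fiber u) -> ell2 R (fiber u).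

Definition opfam0 : opfam := fun u x => 0.
Definition opfamD (a b : opfam) : opfam := fun u x => a u x + b u x.
Definition opfamZ (c : R[i]) (a : opfam) : opfam := fun u x => c *: a u x.
Definition opfamM (a b : opfam) : opfam := fun u x => a u (b u x).

(* [b] is the (necessarily unique) family of adjoints of [a]. *)
Definition opfam_adjoint (a b : opfam) :=
  forall u (x y : ell2 R (fiber u)), ell2_dot (a u x) y = ell2_dot x (b u y).

(* Every component of [a] has operator norm at most [M]. *)
Definition opfam_norm_le (a : opfam) (M : R) :=
  forall u x, ell2_norm (a u x) <= M * ell2_norm x.

Definition bounded_opfam (a : opfam) :=
  (forall u, linear (a u)) /\ exists M, opfam_norm_le a M.

Definition opfam_dist_le (a b : opfam) (e : R) :=
  opfam_norm_le (fun u x => a u x - b u x) e.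

Definition opfam_closure (S : set opfam) : set opfam :=
  [set a | bounded_opfam a /\
           forall e, 0 < e -> exists2 b, S b & opfam_dist_le a b e].

Definition fiber_self (a : G) : fiber (gsrc a) := exist _ a (eqxx (gsrc a)).

Lemma fiber_unit_subproof (u : gunits G) : gsrc (gunit u) == u.
Proof. by rewrite gsrc_unit. Qed.

Definition fiber_unit (u : gunits G) : fiber u :=
  exist _ (gunit u) (fiber_unit_subproof u).

Lemma fiber_mul_subproof (u : gunits G) (c : fiber u)
  (a : fiber (grng (val c))) : gsrc (gmul (val a) (val c)) == u.
Proof. by rewrite gsrcM; [exact: (valP c) | exact/eqP/(valP a)]. Qed.

Definition fiber_mul (u : gunits G) (c : fiber u) (a : fiber (grng (val c))) :
  fiber u := exist _ (gmul (val a) (val c)) (fiber_mul_subproof a).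

(* [b] is the family of the L_u(f), i.e. of the bounded operators such that
   L_u(f) delta_c is the sum of the f(a) delta_(a c), for a in G_(r(c)). The
   sum is evaluated at d in G_u, where at most one term is nonzero. *)
Definition regular_rep (f : G -> R[i]) (b : opfam) :=
  bounded_opfam b /\
  forall u (c d : fiber u), b u (delta R c) d =
    \sum_(a \in [set: fiber (grng (val c))])
      f (val a) * delta R (fiber_mul a) d.

(* C*_r(G) is the closure of the image of C(G) under the direct sum of the L_u,
   which is complete because the algebra of bounded families is; the extension
   of L_u to C*_r(G) is [fun a => a u]. *)
Definition Cr : set opfam :=
  opfam_closure [set b | exists2 f, @CG R G f & regular_rep f b].

Definition jmap (a : opfam) : G -> R[i] := fun c =>
  ell2_dot (a (gsrc c) (delta R (fiber_unit (gsrc c)))) (delta R (fiber_self c)).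

Definition supp (h : G -> R[i]) : set G := [set c | h c != 0].

Definition C0 (h : gunits G -> R[i]) :=
  continuous h /\
  forall e, 0 < e -> exists2 K, compact K & forall u, ~ K u -> `|h u| < e.

Definition extend_by_0 (h : gunits G -> R[i]) : G -> R[i] := fun a =>
  if a == gunit (gsrc a) then h (gsrc a) else 0.

(* [a] is the image of [h] under the continuous extension to C_0 of the
   inclusion of C_c of the unit space in C(G). *)
Definition C0_embedding (h : gunits G -> R[i]) (a : opfam) :=
  bounded_opfam a /\
  forall e, 0 < e -> exists g b,
    [/\ Cc setT g, forall u, `|h u - g u| <= e%:C%C,
        regular_rep (extend_by_0 g) b & opfam_dist_le a b e].

Definition C0units : set opfam :=
  [set a | exists2 h, C0 h & C0_embedding h a].

(* [rho], restricted to C*_r(G), is a *-homomorphism to [B]; its values outside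
   C*_r(G) are irrelevant. *)
Definition Cr_star_hom (B : cstarAlgType R) (rho : opfam -> B) :=
  [/\ {in Cr &, forall a b, rho (opfamD a b) = rho a + rho b},
      forall c, {in Cr, forall a, rho (opfamZ c a) = c *: rho a},
      {in Cr &, forall a b, rho (opfamM a b) = cmul (rho a) (rho b)} &
      {in Cr &, forall a b, opfam_adjoint a b -> rho b = cstar (rho a)}].

End operators.

(* Main.v *)
(** Let [rho] kill [a <> 0]. The support of [j(a)] contains an open bisection, and
    by effectiveness and Baire's theorem that bisection contains an arrow [c] whose
    source [u] has trivial isotropy. Multiplying [a] by a function on a bisection
    moves [c] to [u], giving [b] with [rho b = 0] and [j(b)(u) <> 0].

    Approximate [b] by some [f] in C(G). Trivial isotropy at [u] gives a
    neighbourhood [N] of [u] such that compressing [f] by functions supported in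
    [N] leaves only its restriction to the units, which is continuous and nonzero
    on [N]. So for suitable [p] and [w] in C_c(N), [p * f * w = w ^ 2], whence
    [rho (w ^ 2) = rho p * rho (f - b) * rho w] has norm less than 1. If [m] is a
    function with [m * w = m] and [m(u) <> 0], then [rho m = rho m * rho (w ^ 2)]
    forces [rho m = 0], against injectivity on C_0.

    The boundedness of [rho] needs no spectral theory: for self-adjoint [x] with
    [|x| <= 1/2] the equation [2 y = x ^ 2 + y ^ 2] has a self-adjoint solution
    [y] commuting with [x], so [rho x + i (1 - rho y)] is unitary and
    [|rho x| <= 1]. *)
Require Import Defs.
From mathcomp Require Import all_boot all_order all_algebra.
From mathcomp Require Import all_classical all_reals all_analysis.
From mathcomp Require Import finmap ring lra complex.
From mathcomp.analysis.showcase Require summability.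

Set Implicit Arguments.
Unset Strict Implicit.
Unset Printing Implicit Defensive.

Import Order.TTheory GRing.Theory Num.Theory.
Import numFieldNormedType.Exports.

Local Open Scope classical_set_scope.
Local Open Scope ring_scope.

(** * The spaces l^2(X) *)

(** The obstacle is that [G] need not be Hausdorff. An element of C(G) is a finite sum of functions,
    each continuous only on its own bisection, and even its restriction to the units may be
    discontinuous. Trivial isotropy at [u] controls every summand separately: its bisection has at
    most one arrow with source [u], and that arrow is either the unit at [u] or ends at another
    unit. In the second case, or if there is no such arrow, the Hausdorff unit space allows the
    summand to be cut off near [u].

    No continuity of [rho] is assumed, so the approximation of [b] by [f] says nothing about [rho]
    until boundedness is proved. A crude bound is enough, because the approximation error is free to
    absorb the constant. The auxiliary [y] is 1 - (1 - x^2)^(1/2): the equation 2 y = x^2 + y^2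
    characterizes it without square roots and without a unit, and being polynomial it passes to
    [rho x] and [rho y]. *)

Section cabs.
Context {R : realType}.
Implicit Types z w : R[i].

(** The norm of [R[i]] takes its values in [R[i]]; a modulus with values in [R] can be compared with
    the real bounds on operators. *)
Definition cabs z : R := complex.Re `|z|.

Lemma cabsE z : `|z| = (cabs z)%:C%C.
Proof. by rewrite /cabs normc_def. Qed.

Lemma cabs_ge0 z : 0 <= cabs z.
Proof. by rewrite -lecR -cabsE normr_ge0. Qed.

Lemma cabs0 : cabs 0 = 0.
Proof. by rewrite /cabs normr0. Qed.

Lemma cabs0_eq z : cabs z = 0 -> z = 0.
Proof. by move=> z0; apply/eqP; rewrite -normr_eq0 cabsE z0. Qed.

Lemma cabsM z w : cabs (z * w) = cabs z * cabs w.
Proof. by apply/complexI; rewrite rmorphM -!cabsE normrM. Qed.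

Lemma cabsD z w : cabs (z + w) <= cabs z + cabs w.
Proof. by rewrite -lecR rmorphD -!cabsE ler_normD. Qed.

Lemma cabsN z : cabs (- z) = cabs z.
Proof. by rewrite /cabs normrN. Qed.

Lemma cabsV z : cabs z^-1 = (cabs z)^-1.
Proof. by apply/complexI; rewrite fmorphV -!cabsE normfV. Qed.

Lemma cabs_conj z : cabs (Num.conj z) = cabs z.
Proof. by rewrite /cabs norm_conjC. Qed.

Lemma cabs_real (x : R) : cabs x%:C%C = `|x|.
Proof. by rewrite /cabs normc_def /= expr0n addr0 sqrtr_sqr. Qed.

Lemma sqr_cabs z : cabs z ^+ 2 = normsq z.
Proof. by apply/complexI; rewrite normsqE cabsE rmorphXn. Qed.

Lemma cabs_le z (M : R) : 0 <= M -> (cabs z <= M) = (normsq z <= M ^+ 2).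
Proof. by move=> M0; rewrite -sqr_cabs ler_sqr ?nnegrE ?cabs_ge0. Qed.

Lemma normsqN z : normsq (- z) = normsq z.
Proof. by rewrite -!sqr_cabs cabsN. Qed.

Lemma normsq0 : normsq (0 : R[i]) = 0.
Proof. by rewrite -sqr_cabs cabs0 expr0n. Qed.

(* AM-GM on the cross term. *)
Lemma normsqD_weighted z w (s t : R) : 0 < s -> 0 < t ->
  normsq (z + w) <= (s + t) / s * normsq z + (s + t) / t * normsq w.
Proof.
move=> s0 t0; rewrite -!sqr_cabs.
apply: (@le_trans _ _ ((cabs z + cabs w) ^+ 2)).
  by rewrite ler_sqr ?nnegrE ?addr_ge0 ?cabs_ge0 ?cabsD.
rewrite -subr_ge0; set a := cabs z; set b := cabs w.
have -> : (s + t) / s * a ^+ 2 + (s + t) / t * b ^+ 2 - (a + b) ^+ 2 =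
   (t * a - s * b) ^+ 2 / (s * t).
  by field; rewrite ?mulf_neq0 ?gt_eqF.
by rewrite divr_ge0 ?sqr_ge0// mulr_ge0 ?ltW.
Qed.

End cabs.

Section ell2_norm.
Context (R : realType) (X : choiceType).
Implicit Types (x y : ell2 R X) (c : R[i]) (M : R).

Lemma sum_normsq_le_sqsum (x : X -> R[i]) (s : seq X) : uniq s ->
  ((\sum_(i <- s) normsq (x i))%:E <= sqsum x)%E.
Proof.
move=> us; apply: ereal_sup_ubound; exists [set` s] => /=.
  by split => //; exact: finite_seq.
by rewrite -fsbig_seq// sumEFin.
Qed.

Lemma sqsum_le (x : X -> R[i]) M :
  (forall s : seq X, uniq s -> \sum_(i <- s) normsq (x i) <= M) ->
  (sqsum x <= M%:E)%E.
Proof.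
move=> xM; apply: ge_ereal_sup => _ [A [finA _] <-].
by rewrite fsbig_finite// sumEFin lee_fin xM// fset_uniq.
Qed.

Lemma sqsum_fin (x : ell2 R X) : sqsum x = (fine (sqsum x))%:E.
Proof.
rewrite fineK// ge0_fin_numE ?sqsum_ge0//.
by have := valP x; rewrite inE.
Qed.

Lemma ell2_norm_ge0 x : 0 <= ell2_norm x.
Proof. exact: sqrtr_ge0. Qed.

Lemma sqr_ell2_norm x : (ell2_norm x ^+ 2)%:E = sqsum x.
Proof. by rewrite sqr_sqrtr ?fine_ge0 ?sqsum_ge0// -sqsum_fin. Qed.

Lemma sum_normsq_le x (s : seq X) : uniq s ->
  \sum_(i <- s) normsq (x i) <= ell2_norm x ^+ 2.
Proof. by move=> us; rewrite -lee_fin sqr_ell2_norm sum_normsq_le_sqsum. Qed.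

Lemma ell2_norm_le x M : 0 <= M ->
  (forall s : seq X, uniq s -> \sum_(i <- s) normsq (x i) <= M ^+ 2) ->
  ell2_norm x <= M.
Proof.
move=> M0 /sqsum_le; rewrite -sqr_ell2_norm lee_fin.
by rewrite ler_sqr ?nnegrE ?ell2_norm_ge0.
Qed.

Lemma ell2_of_bound (x : X -> R[i]) M : 0 <= M ->
  (forall s : seq X, uniq s -> \sum_(i <- s) normsq (x i) <= M ^+ 2) ->
  exists2 y : ell2 R X, y = x :> (X -> R[i]) & ell2_norm y <= M.
Proof.
move=> M0 xM.
have xl : x \in @sqsummable R X.
  by rewrite inE (le_lt_trans (sqsum_le xM))// ltry.
by exists (Ell2 xl) => //; exact: ell2_norm_le.
Qed.

Lemma ell2P x y : (forall i, x i = y i) -> x = y.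
Proof. by move=> xy; apply/val_inj/funext. Qed.

Lemma ell2D_coord x y i : (x + y) i = x i + y i. Proof. by []. Qed.
Lemma ell2Z_coord c x i : (c *: x) i = c * x i. Proof. by []. Qed.
Lemma ell2N_coord x i : (- x) i = - x i. Proof. by []. Qed.
Lemma ell2B_coord x y i : (x - y) i = x i - y i. Proof. by []. Qed.
Lemma ell20_coord i : (0 : ell2 R X) i = 0. Proof. by []. Qed.

Lemma ell2_sum_coord I (r : seq I) (F : I -> ell2 R X) i :
  (\sum_(k <- r) F k) i = \sum_(k <- r) F k i.
Proof. by elim/big_rec2: _ => // k y z _ <-. Qed.

Lemma coord_le x i : cabs (x i) <= ell2_norm x.
Proof.
rewrite cabs_le ?ell2_norm_ge0//.
by have := @sum_normsq_le x [:: i] isT; rewrite big_seq1.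
Qed.

Lemma ell2_norm0_eq x : ell2_norm x = 0 -> x = 0.
Proof.
move=> x0; apply/ell2P => i; rewrite ell20_coord; apply: cabs0_eq.
by apply/eqP; rewrite eq_le cabs_ge0 andbT -x0 coord_le.
Qed.

Lemma ell2_norm0 : ell2_norm (0 : ell2 R X) = 0.
Proof.
apply/eqP; rewrite eq_le ell2_norm_ge0 andbT ell2_norm_le// => s _.
by rewrite expr0n big1// => i _; rewrite normsq0.
Qed.

(** Weighting [normsqD_weighted] by the norms themselves makes the two terms add up to
    [(s + t) ^+ 2], so Cauchy-Schwarz is not involved. The summand [e / 2] keeps both weights
    positive. *)
Lemma ell2_normD x y : ell2_norm (x + y) <= ell2_norm x + ell2_norm y.
Proof.
apply/ler_addgt0Pr => e e0.
pose s := ell2_norm x + e / 2; pose t := ell2_norm y + e / 2.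
have e2 : 0 < e / 2 by rewrite divr_gt0.
have s0 : 0 < s by rewrite ltr_wpDl ?ell2_norm_ge0.
have t0 : 0 < t by rewrite ltr_wpDl ?ell2_norm_ge0.
have -> : ell2_norm x + ell2_norm y + e = s + t by rewrite /s /t; field.
apply: ell2_norm_le; first by rewrite addr_ge0 ?ltW.
move=> r ur; apply: (@le_trans _ _ ((s + t) / s * \sum_(i <- r) normsq (x i) +
    (s + t) / t * \sum_(i <- r) normsq (y i))).
  rewrite !mulr_sumr -big_split /=.
  by apply: ler_sum => i _; exact: normsqD_weighted.
have -> : (s + t) ^+ 2 = (s + t) / s * s ^+ 2 + (s + t) / t * t ^+ 2.
  by field; rewrite !gt_eqF.
have bound (z : ell2 R X) v : ell2_norm z <= v ->
    \sum_(i <- r) normsq (z i) <= v ^+ 2.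
  move=> zv; apply: le_trans (sum_normsq_le z ur) _.
  by rewrite ler_sqr ?nnegrE ?ell2_norm_ge0// (le_trans (ell2_norm_ge0 z)).
have ds : 0 <= (s + t) / s by rewrite ltW// divr_gt0// addr_gt0.
have dt : 0 <= (s + t) / t by rewrite ltW// divr_gt0// addr_gt0.
by rewrite lerD// ler_wpM2l// bound// lerDl ltW.
Qed.

Lemma ell2_normZ_le c x : ell2_norm (c *: x) <= cabs c * ell2_norm x.
Proof.
apply: ell2_norm_le; first by rewrite mulr_ge0 ?cabs_ge0 ?ell2_norm_ge0.
move=> s us; rewrite exprMn sqr_cabs.
under eq_bigr do rewrite ell2Z_coord normsqM.
by rewrite -mulr_sumr ler_wpM2l ?normsq_ge0 ?sum_normsq_le.
Qed.

Lemma ell2_normN x : ell2_norm (- x) = ell2_norm x.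
Proof.
congr (Num.sqrt (fine _)); rewrite /sqsum; apply: eq_esum => i _.
by rewrite normsqN.
Qed.

Lemma ell2_normBC x y : ell2_norm (x - y) = ell2_norm (y - x).
Proof. by rewrite -ell2_normN opprB. Qed.

Lemma ell2_norm_tri x y z :
  ell2_norm (x - z) <= ell2_norm (x - y) + ell2_norm (y - z).
Proof. by rewrite -[x - z](subrKA y) ell2_normD. Qed.

Lemma ell2_sum_cvg x e : 0 < e -> exists2 s : seq X, uniq s &
  ell2_norm x ^+ 2 - e < \sum_(i <- s) normsq (x i).
Proof.
move=> e0; have xfin : sqsum x \is a fin_num by rewrite sqsum_fin.
have /= [_ [A [finA _] <-]] := ub_ereal_sup_adherent e0 xfin.
rewrite -/(esum _ _) -/(sqsum x) -sqr_ell2_norm fsbig_finite// sumEFin.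
rewrite -EFinB lte_fin => lt.
by exists (fset_set A); rewrite ?fset_uniq.
Qed.

Lemma delta_coord (i k : X) : delta R i k = (k == i)%:R. Proof. by []. Qed.

Lemma delta_decomp_coord x (s : seq X) k : uniq s ->
  (x - \sum_(i <- s) x i *: delta R i) k = if k \in s then 0 else x k.
Proof.
move=> us; rewrite ell2B_coord ell2_sum_coord.
under eq_bigr do rewrite ell2Z_coord delta_coord mulr_natr mulrb.
case: ifPn => ks.
  rewrite (bigD1_seq k)//= eqxx big1 ?addr0 ?subrr// => i ik.
  by rewrite eq_sym (negbTE ik).
rewrite big_seq big1 ?subr0// => i si; case: eqP => // ki.
by rewrite ki si in ks.
Qed.

(** The residual is supported off [s], so its mass on any finite set is at most the mass of [x]
    missed by [s], which is less than [e ^+ 2]. *)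
Lemma ell2_finite_approx x e : 0 < e ->
  exists s : seq X, ell2_norm (x - \sum_(i <- s) x i *: delta R i) <= e.
Proof.
move=> e0; have [s us lt] := ell2_sum_cvg x (exprn_gt0 2 e0).
exists s; apply: ell2_norm_le; first exact: ltW.
move=> r ur; under eq_bigr do rewrite delta_decomp_coord//.
rewrite (bigID (mem s))/= big1 ?add0r; last by move=> i ->; rewrite normsq0.
rewrite (eq_bigr (fun i => normsq (x i))); last by move=> i /negbTE ->.
have := @sum_normsq_le x (s ++ [seq i <- r | i \notin s]).
rewrite cat_uniq us filter_uniq// andbT /= big_cat/= big_filter => le.
have {}le := le _.
suff /le : ~~ has (in_mem^~ (mem s)) [seq i <- r | i \notin s].
  by move: lt; set A := \sum_(i <- s) _; set B := \sum_(i <- r | _) _; lra.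
by apply/hasPn => i; rewrite mem_filter => /andP[].
Qed.

(** Finite combinations of basis vectors are dense. This is what reduces identities between bounded
    operators to identities between matrix coefficients. *)
Lemma functional_ext (phi : ell2 R X -> R[i]) M : 0 <= M ->
  (forall x y, phi (x + y) = phi x + phi y) ->
  (forall c x, phi (c *: x) = c * phi x) ->
  (forall x, cabs (phi x) <= M * ell2_norm x) ->
  (forall i, phi (delta R i) = 0) -> forall x, phi x = 0.
Proof.
move=> M0 phiD phiZ phiM phi0 x; apply: cabs0_eq; apply/eqP.
rewrite eq_le cabs_ge0 andbT; apply/ler_addgt0Pr => e e0; rewrite add0r.
have d0 : 0 < e / (M + 1) by rewrite divr_gt0// ltr_wpDl.
have [s sx] := ell2_finite_approx x d0.
have -> : phi x = phi (x - \sum_(i <- s) x i *: delta R i).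
  rewrite phiD -scaleN1r phiZ; set z := (X in _ + _ * phi X).
  suff -> : phi z = 0 by rewrite mulr0 addr0.
  have zero : phi 0 = 0 by rewrite -(scale0r 0) phiZ mul0r.
  rewrite /z; elim: (s) => [|i r IH]; first by rewrite big_nil.
  by rewrite big_cons phiD phiZ phi0 mulr0 add0r.
apply: le_trans (phiM _) _; apply: (@le_trans _ _ (M * (e / (M + 1)))).
  by rewrite ler_wpM2l.
by rewrite mulrA ler_pdivrMr ?ltr_wpDl// mulrC ler_wpM2l ?lerDl// ltW.
Qed.

End ell2_norm.

#[local] Existing Instance summability.totally_filter.
Section ell2_dot.
Context (R : realType) (X : choiceType).
Implicit Types (x y z : ell2 R X) (c : R[i]).

Let psum (x : X -> R[i]) := @summability.partial_sum X R[i] x.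

Let psumE (f : X -> R[i]) A : psum f A = \sum_(i <- A) f i.
Proof. by rewrite big_seq_fsetE. Qed.

Lemma conj_real (r : R) : Num.conj r%:C%C = r%:C%C.
Proof. by rewrite conj_Creal// complex_real. Qed.

Lemma gt0_complex (e : R[i]) : 0 < e -> exists2 d : R, 0 < d & e = d%:C%C.
Proof.
move=> e0; exists (cabs e); last by rewrite -cabsE gtr0_norm.
by rewrite -ltcR -cabsE normr_gt0 gt_eqF.
Qed.

Lemma cvg_sum_normsq x :
  psum (fun i => (normsq (x i))%:C%C) @ summability.totally
    --> (ell2_norm x ^+ 2)%:C%C.
Proof.
apply/cvgrPdist_le => /= _ /gt0_complex[e e0 ->].
have [s us lt] := ell2_sum_cvg x e0.
exists [fset i in s]%fset => // A /= sA.
rewrite psumE -rmorph_sum -rmorphB cabsE lecR.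
rewrite cabs_real ger0_norm; last first.
  by rewrite subr_ge0 sum_normsq_le ?fset_uniq.
rewrite lerBlDr -lerBlDl; apply: le_trans (ltW lt) _.
rewrite [leRHS](bigID (mem s))/=.
suff -> : \sum_(i <- A | i \in s) normsq (x i) = \sum_(i <- s) normsq (x i).
  by rewrite lerDl sumr_ge0// => i _; rewrite normsq_ge0.
rewrite -big_filter; apply: perm_big.
apply: uniq_perm; rewrite ?filter_uniq ?fset_uniq// => i.
rewrite mem_filter; apply/andb_idr => si.
by apply: (fsubsetP sA); rewrite inE.
Qed.

Lemma polarization (z w : R[i]) : z * Num.conj w = 4^-1 *
  ((normsq (z + w))%:C%C - (normsq (z - w))%:C%C +
   'i%C * (normsq (z + 'i%C * w))%:C%C - 'i%C * (normsq (z - 'i%C * w))%:C%C).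
Proof.
have n4 : 4 != 0 :> R[i] by rewrite pnatr_eq0.
apply: (mulfI n4); rewrite [RHS]mulrA divff// mul1r.
have -> : 4 = (4 : R)%:C%C by rewrite rmorph_nat.
case: z w => [a b] [c d]; rewrite /normsq /=; apply/eqP.
by rewrite eq_complex; apply/andP; split; apply/eqP => /=; ring.
Qed.

(** Polarization writes every term as a combination of four squared moduli, and the sums of these
    converge to squared norms. *)
Lemma cvg_dot x y : psum (fun i => x i * Num.conj (y i)) @ summability.totally
  --> ell2_dot x y.
Proof.
pose L := 4^-1 * ((ell2_norm (x + y) ^+ 2)%:C%C - (ell2_norm (x - y) ^+ 2)%:C%C +
   'i%C * (ell2_norm (x + 'i%C *: y) ^+ 2)%:C%C -
   'i%C * (ell2_norm (x - 'i%C *: y) ^+ 2)%:C%C).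
have cL : psum (fun i => x i * Num.conj (y i)) @ summability.totally --> L.
  rewrite [X in X @ _ --> _](_ : _ = fun A => 4^-1 *
     (psum (fun i => (normsq ((x + y) i))%:C%C) A -
      psum (fun i => (normsq ((x - y) i))%:C%C) A +
      'i%C * psum (fun i => (normsq ((x + 'i%C *: y) i))%:C%C) A -
      'i%C * psum (fun i => (normsq ((x - 'i%C *: y) i))%:C%C) A)).
    apply: cvgMl_tmp; apply: cvgB; [apply: cvgD; [apply: cvgB|]|];
      rewrite ?(cvg_sum_normsq) //; try (apply: cvgMl_tmp); exact: cvg_sum_normsq.
  apply/funext => A; rewrite !psumE.
  rewrite !mulr_sumr -!sumrB -big_split/= -sumrB mulr_sumr.
  apply: eq_bigr => i _; rewrite polarization.
  by rewrite ?(ell2D_coord, ell2B_coord, ell2Z_coord).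
rewrite /ell2_dot /summability.sum.
by have /cvg_lim -> // := cL.
Qed.

Lemma dot_eq x y (l : R[i]) :
  psum (fun i => x i * Num.conj (y i)) @ summability.totally --> l ->
  ell2_dot x y = l.
Proof. by move=> cl; apply: cvg_lim. Qed.

Lemma dotDl x y z : ell2_dot (x + y) z = ell2_dot x z + ell2_dot y z.
Proof.
apply: dot_eq; rewrite [X in X @ _ --> _](_ : _ =
  psum (fun i => x i * Num.conj (z i)) \+ psum (fun i => y i * Num.conj (z i))).
  by apply: cvgD; exact: cvg_dot.
apply/funext => A; rewrite /= !psumE -big_split /=.
by apply: eq_bigr => i _; exact: mulrDl.
Qed.

Lemma dotZl c x y : ell2_dot (c *: x) y = c * ell2_dot x y.
Proof.
apply: dot_eq; rewrite [X in X @ _ --> _](_ : _ =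
  fun A => c * psum (fun i => x i * Num.conj (y i)) A).
  by apply: cvgMl_tmp; exact: cvg_dot.
apply/funext => A; rewrite !psumE mulr_sumr.
by apply: eq_bigr => i _; rewrite ell2Z_coord mulrA.
Qed.

Lemma dotC x y : ell2_dot y x = Num.conj (ell2_dot x y).
Proof.
apply: dot_eq; rewrite [X in X @ _ --> _](_ : _ =
  fun A => Num.conj (psum (fun i => x i * Num.conj (y i)) A)); last first.
  apply/funext => A; rewrite !psumE rmorph_sum.
  by apply: eq_bigr => i _; rewrite rmorphM /= conjCK mulrC.
apply/cvgrPdist_le => /= e e0.
have /cvgrPdist_le/(_ e e0) := @cvg_dot x y.
by apply: filterS => A; rewrite -rmorphB norm_conjC.
Qed.

Lemma dotDr x y z : ell2_dot x (y + z) = ell2_dot x y + ell2_dot x z.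
Proof. by rewrite !(dotC _ x) dotDl rmorphD. Qed.

Lemma dotZr c x y : ell2_dot x (c *: y) = Num.conj c * ell2_dot x y.
Proof. by rewrite !(dotC _ x) dotZl rmorphM. Qed.

Lemma dot_self x : ell2_dot x x = (ell2_norm x ^+ 2)%:C%C.
Proof.
apply: dot_eq; rewrite (_ : (fun i => _) = fun i => (normsq (x i))%:C%C).
  exact: cvg_sum_normsq.
by apply/funext => i; rewrite normsqE normCK.
Qed.

Lemma dot_delta x i : ell2_dot x (delta R i) = x i.
Proof.
apply: dot_eq; apply: cvg_near_cst; exists [fset i]%fset => // A /= iA.
rewrite psumE (bigD1_seq i) ?fset_uniq//=; last by rewrite (fsubsetP iA) ?inE.
rewrite /delta_fun eqxx rmorph1 mulr1 big1 ?addr0// => k ki.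
by rewrite (negbTE ki) rmorph0 mulr0.
Qed.

Lemma dot_le x y : cabs (ell2_dot x y) <= ell2_norm x * ell2_norm y.
Proof.
have [y0|y0] := eqVneq (ell2_norm y) 0.
  have -> : ell2_dot x y = 0.
    by rewrite (ell2_norm0_eq y0) -(scale0r 0) dotZr rmorph0 mul0r.
  by rewrite cabs0 mulr_ge0 ?ell2_norm_ge0.
set d := ell2_dot x y; set b := ell2_norm y in y0 *.
have b0 : 0 < b by rewrite lt_neqAle eq_sym y0 ell2_norm_ge0.
(* The coefficient that minimizes the norm of [x + t *: y]. *)
pose t : R[i] := - d / (b ^+ 2)%:C%C.
have : 0 <= ell2_dot (x + t *: y) (x + t *: y).
  by rewrite dot_self lecR sqr_ge0.
have -> : ell2_dot (x + t *: y) (x + t *: y) =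
  (ell2_norm x ^+ 2 - (cabs d / b) ^+ 2)%:C%C.
  rewrite dotDl !dotDr !dotZl !dotZr !dot_self -/b -/d (dotC x y) -/d.
  have -> : Num.conj t = - Num.conj d / (b ^+ 2)%:C%C.
    by rewrite /t rmorphM rmorphN fmorphV /= conj_real.
  rewrite exprMn sqr_cabs exprVn; set N := _ ^+ 2; set B := b ^+ 2.
  rewrite rmorphB (rmorphM _ (normsq d)) (fmorphV _ B) /= normsqE normCK /t -/B.
  have : B%:C%C != 0 :> R[i] by rewrite (inj_eq (@complexI R)) sqrf_eq0.
  by set C := B%:C%C => C0; field.
rewrite lecR subr_ge0.
rewrite ler_sqr ?nnegrE ?ell2_norm_ge0 ?divr_ge0 ?cabs_ge0 ?(ltW b0)//.
by rewrite ler_pdivrMr.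
Qed.

End ell2_dot.

(** * Families of bounded operators *)

Section bounded_operators.
Context (R : realType) (X : choiceType).
Implicit Types (x y : ell2 R X) (S T : ell2 R X -> ell2 R X).

Lemma operator_ext S T (M N : R) : linear S -> linear T -> 0 <= M -> 0 <= N ->
  (forall x, ell2_norm (S x) <= M * ell2_norm x) ->
  (forall x, ell2_norm (T x) <= N * ell2_norm x) ->
  (forall i k, S (delta R i) k = T (delta R i) k) -> S = T.
Proof.
move=> Slin Tlin M0 N0 SM TN ST; apply/funext => x; apply/ell2P => k.
apply/eqP; rewrite -subr_eq0; apply/eqP.
have SD a b : S (a + b) = S a + S b by have := Slin 1 a b; rewrite !scale1r.
have TD a b : T (a + b) = T a + T b by have := Tlin 1 a b; rewrite !scale1r.
have S0 : S 0 = 0 by have := Slin (- 1) 0 0; rewrite scaler0 addr0 scaleN1r addNr.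
have T0 : T 0 = 0 by have := Tlin (- 1) 0 0; rewrite scaler0 addr0 scaleN1r addNr.
apply: (@functional_ext R X (fun x => S x k - T x k) (M + N)).
- exact: addr_ge0.
- by move=> a b; rewrite SD TD !ell2D_coord; ring.
- move=> c a; have := Slin c a 0; have := Tlin c a 0.
  by rewrite !addr0 S0 T0 !addr0 => -> ->; rewrite !ell2Z_coord mulrBr.
- move=> a; apply: le_trans (cabsD _ _) _; rewrite cabsN mulrDl lerD//.
    exact: le_trans (coord_le _ _) (SM _).
  exact: le_trans (coord_le _ _) (TN _).
- by move=> i; rewrite ST subrr.
Qed.

(** [functional_ext] is applied twice: in [x] against a fixed basis vector, then in [y], where a
    conjugation turns the dependence into a linear one. *)
Lemma adjoint_of_matrix S T (M N : R) : linear S -> linear T -> 0 <= M -> 0 <= N ->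
  (forall x, ell2_norm (S x) <= M * ell2_norm x) ->
  (forall x, ell2_norm (T x) <= N * ell2_norm x) ->
  (forall i k, S (delta R i) k = Num.conj (T (delta R k) i)) ->
  forall x y, ell2_dot (S x) y = ell2_dot x (T y).
Proof.
move=> Slin Tlin M0 N0 SM TN ST.
have SD a b : S (a + b) = S a + S b by have := Slin 1 a b; rewrite !scale1r.
have TD a b : T (a + b) = T a + T b by have := Tlin 1 a b; rewrite !scale1r.
have S0 : S 0 = 0 by have := Slin (- 1) 0 0; rewrite scaler0 addr0 scaleN1r addNr.
have T0 : T 0 = 0 by have := Tlin (- 1) 0 0; rewrite scaler0 addr0 scaleN1r addNr.
have SZ c a : S (c *: a) = c *: S a by have := Slin c a 0; rewrite S0 !addr0.
have TZ c a : T (c *: a) = c *: T a by have := Tlin c a 0; rewrite T0 !addr0.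
have bound a b : cabs (ell2_dot (S a) b - ell2_dot a (T b)) <=
    (M + N) * (ell2_norm a * ell2_norm b).
  apply: le_trans (cabsD _ _) _; rewrite cabsN mulrDl lerD//.
    apply: le_trans (dot_le _ _) _; rewrite mulrA ler_wpM2r ?ell2_norm_ge0//.
  apply: le_trans (dot_le _ _) _.
  by rewrite mulrCA ler_wpM2l ?ell2_norm_ge0.
have col k x : ell2_dot (S x) (delta R k) - ell2_dot x (T (delta R k)) = 0.
  apply: (@functional_ext R X (fun x => ell2_dot (S x) (delta R k) -
    ell2_dot x (T (delta R k))) ((M + N) * ell2_norm (delta R k))).
  - by rewrite mulr_ge0 ?addr_ge0 ?ell2_norm_ge0.
  - by move=> a b; rewrite SD !dotDl; ring.
  - by move=> c a; rewrite SZ !dotZl mulrBr.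
  - by move=> a; rewrite -mulrA (mulrC (ell2_norm _)).
  - by move=> i; rewrite dot_delta dotC dot_delta ST subrr.
move=> x y; apply/eqP; rewrite -subr_eq0 -(inj_eq (inv_inj (@conjCK _))) rmorph0.
apply/eqP.
apply: (@functional_ext R X (fun y => Num.conj (ell2_dot (S x) y -
    ell2_dot x (T y))) ((M + N) * ell2_norm x)).
- by rewrite mulr_ge0 ?addr_ge0 ?ell2_norm_ge0.
- by move=> a b; rewrite TD !dotDr !rmorphB !rmorphD /=; ring.
- by move=> c a; rewrite TZ !dotZr -mulrBr rmorphM /= conjCK.
- by move=> a; rewrite cabs_conj -mulrA.
- by move=> k; rewrite col rmorph0.
Qed.

(** Where the weight is nonzero, [p] never repeats a coordinate of [x], so the squares of the image
    are dominated by [M ^+ 2] times those of [x]. Injectivity is asked only there because a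
    bisection moves only part of a fibre. *)
Lemma weighted_perm_operator (w : X -> R[i]) (p : X -> X) (M : R) : 0 <= M ->
  (forall i, cabs (w i) <= M) ->
  (forall i k, w i != 0 -> w k != 0 -> p i = p k -> i = k) ->
  exists T : ell2 R X -> ell2 R X, [/\ linear T,
    forall x, ell2_norm (T x) <= M * ell2_norm x &
    forall x i, T x i = w i * x (p i)].
Proof.
move=> M0 wM pinj.
have ex x : exists y : ell2 R X, ell2_norm y <= M * ell2_norm x /\
    forall i, y i = w i * x (p i).
  have [|s us|y yE yM] := @ell2_of_bound R X (fun i => w i * x (p i))
    (M * ell2_norm x).
  - by rewrite mulr_ge0 ?ell2_norm_ge0.
  - rewrite (bigID (fun i => w i == 0))/= big1 ?add0r; last first.
      by move=> i /eqP ->; rewrite mul0r normsq0.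
    have -> : (M * ell2_norm x) ^+ 2 = M ^+ 2 * ell2_norm x ^+ 2 by rewrite exprMn.
    pose r := [seq p i | i <- s & w i != 0].
    have ur : uniq r.
      rewrite map_inj_in_uniq ?filter_uniq// => i k.
      by rewrite !mem_filter => /andP[wi _] /andP[wk _]; exact: pinj.
    apply: (@le_trans _ _ (\sum_(i <- s | w i != 0) M ^+ 2 * normsq (x (p i)))).
      apply: ler_sum => i _; rewrite normsqM ler_wpM2r ?normsq_ge0//.
      by rewrite -cabs_le.
    rewrite -mulr_sumr ler_wpM2l ?sqr_ge0//.
    by have := @sum_normsq_le _ _ x r ur; rewrite big_map big_filter.
  by exists y; split => // i; rewrite yE.
pose T x := projT1 (cid (ex x)).
have TE x i : T x i = w i * x (p i) by rewrite /T; case: cid => y [].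
exists T; split => //.
  move=> c x y; apply/ell2P => i.
  by rewrite ell2D_coord ell2Z_coord !TE ell2D_coord ell2Z_coord; ring.
by move=> x; rewrite /T; case: cid => y [].
Qed.

End bounded_operators.

Section opfams.
Context (R : realType) (G : topGroupoid).
Implicit Types (a b c : opfam R G) (M N e : R).

(* Unlike [opfam_norm_le], this requires the bound to be nonnegative. *)
Definition op_bound a M :=
  [/\ forall u, linear (a u), 0 <= M & opfam_norm_le a M].

Lemma bounded_op_bound a : bounded_opfam a -> exists M, op_bound a M.
Proof.
move=> [alin [M aM]]; exists `|M|; split => // u x.
by apply: le_trans (aM u x) _; rewrite ler_wpM2r ?ell2_norm_ge0 ?ler_norm.
Qed.

Lemma op_bound_bounded a M : op_bound a M -> bounded_opfam a.
Proof. by move=> [alin _ aM]; split => //; exists M. Qed.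

Lemma norm_leW a M N : M <= N -> opfam_norm_le a M -> opfam_norm_le a N.
Proof.
move=> MN aM u x; apply: le_trans (aM u x) _.
by rewrite ler_wpM2r ?ell2_norm_ge0.
Qed.

Lemma opD a (alin : forall u, linear (a u)) u x y : a u (x + y) = a u x + a u y.
Proof. by have := alin u 1 x y; rewrite !scale1r. Qed.

Lemma op0 a (alin : forall u, linear (a u)) u : a u 0 = 0.
Proof.
by have := alin u (- 1) 0 0; rewrite scaler0 addr0 scaleN1r addNr.
Qed.

Lemma opZ a (alin : forall u, linear (a u)) u (c : R[i]) x :
  a u (c *: x) = c *: a u x.
Proof. by have := alin u c x 0; rewrite (op0 alin) !addr0. Qed.

Lemma opB a (alin : forall u, linear (a u)) u x y : a u (x - y) = a u x - a u y.
Proof. by rewrite -scaleN1r (opD alin) (opZ alin) scaleN1r. Qed.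

Lemma op_bound_ext a b M N : op_bound a M -> op_bound b N ->
  (forall u (i k : fiber u), a u (delta R i) k = b u (delta R i) k) -> a = b.
Proof.
move=> [alin M0 aM] [blin N0 bN] ab.
apply: functional_extensionality_dep => u.
exact: operator_ext (aM u) (bN u) (ab u).
Qed.

Lemma op_bound_adjoint a b M N : op_bound a M -> op_bound b N ->
  (forall u (i k : fiber u), a u (delta R i) k = Num.conj (b u (delta R k) i)) ->
  opfam_adjoint a b.
Proof.
move=> [alin M0 aM] [blin N0 bN] ab u.
exact: adjoint_of_matrix (aM u) (bN u) (ab u).
Qed.

Lemma op_boundD a b M N : op_bound a M -> op_bound b N ->
  op_bound (opfamD a b) (M + N).
Proof.
move=> [alin M0 aM] [blin N0 bN]; split; last first.
- move=> u x; apply: le_trans (ell2_normD _ _) _; rewrite mulrDl.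
  by apply: lerD; [exact: aM|exact: bN].
- exact: addr_ge0.
- by move=> u c x y; rewrite /opfamD alin blin scalerDr addrACA.
Qed.

Lemma op_boundZ a M (c : R[i]) : op_bound a M -> op_bound (opfamZ c a) (cabs c * M).
Proof.
move=> [alin M0 aM]; split; last first.
- move=> u x; apply: le_trans (ell2_normZ_le _ _) _; rewrite -mulrA.
  by rewrite ler_wpM2l ?cabs_ge0.
- by rewrite mulr_ge0 ?cabs_ge0.
- by move=> u k x y; rewrite /opfamZ alin scalerDr !scalerA mulrC.
Qed.

Lemma op_boundM a b M N : op_bound a M -> op_bound b N ->
  op_bound (opfamM a b) (M * N).
Proof.
move=> [alin M0 aM] [blin N0 bN]; split; last first.
- move=> u x; apply: le_trans (aM _ _) _; rewrite -mulrA.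
  by rewrite ler_wpM2l.
- exact: mulr_ge0.
- by move=> u k x y; rewrite /opfamM blin alin.
Qed.

Lemma op_bound0 : op_bound (@opfam0 R G) 0.
Proof.
split=> // [u c x y|u x]; first by rewrite /opfam0 scaler0 addr0.
by rewrite mul0r ell2_norm0.
Qed.

Lemma dist_sym a b e : opfam_dist_le a b e -> opfam_dist_le b a e.
Proof. by move=> ab u x; rewrite ell2_normBC; exact: ab. Qed.

Lemma dist_tri a b c e e' : opfam_dist_le a b e -> opfam_dist_le b c e' ->
  opfam_dist_le a c (e + e').
Proof.
move=> ab bc u x; apply: le_trans (ell2_norm_tri _ (b u x) _) _.
by rewrite mulrDl lerD// ?ab ?bc.
Qed.

Lemma dist_eq a b : (forall e, 0 < e -> opfam_dist_le a b e) -> a = b.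
Proof.
move=> ab; apply: functional_extensionality_dep => u; apply/funext => x.
apply/eqP; rewrite -subr_eq0; apply/eqP; apply: ell2_norm0_eq; apply/eqP.
rewrite eq_le ell2_norm_ge0 andbT; apply/ler_addgt0Pr => e e0; rewrite add0r.
apply: le_trans (ab (e / (ell2_norm x + 1)) _ u x) _.
  by rewrite divr_gt0// ltr_wpDl ?ell2_norm_ge0.
rewrite mulrAC ler_pdivrMr ?ltr_wpDl ?ell2_norm_ge0//.
by rewrite ler_wpM2l ?(ltW e0)// lerDl.
Qed.

Lemma dist_norm_le a b M e : op_bound a M -> opfam_dist_le a b e ->
  opfam_norm_le b (M + e).
Proof.
move=> [alin M0 aM] ab u x; rewrite -[b u x](subrK (a u x)) addrC mulrDl.
by apply: le_trans (ell2_normD _ _) (lerD (aM _ _) _); rewrite ell2_normBC ab.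
Qed.

Lemma distD a b a' b' e e' : opfam_dist_le a b e -> opfam_dist_le a' b' e' ->
  opfam_dist_le (opfamD a a') (opfamD b b') (e + e').
Proof.
move=> ab ab' u x; rewrite /opfamD opprD addrACA mulrDl.
by apply: le_trans (ell2_normD _ _) (lerD (ab _ _) (ab' _ _)).
Qed.

Lemma distZ a b e (c : R[i]) : opfam_dist_le a b e ->
  opfam_dist_le (opfamZ c a) (opfamZ c b) (cabs c * e).
Proof.
move=> ab u x; rewrite /opfamZ -scalerBr -mulrA.
by apply: le_trans (ell2_normZ_le _ _) (ler_wpM2l (cabs_ge0 _) (ab _ _)).
Qed.

Lemma distM a b a' b' M N e e' : op_bound a M -> opfam_norm_le b' N ->
  0 <= e -> opfam_dist_le a b e -> opfam_dist_le a' b' e' ->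
  opfam_dist_le (opfamM a a') (opfamM b b') (M * e' + e * N).
Proof.
move=> [alin M0 aM] bN e0 ab ab' u x.
rewrite /opfamM -[a u _](subrK (a u (b' u x))) -addrA -(opB alin) mulrDl.
apply: le_trans (ell2_normD _ _) (lerD _ _).
  by apply: le_trans (aM _ _) _; rewrite -mulrA ler_wpM2l.
by apply: le_trans (ab _ _) _; rewrite -mulrA ler_wpM2l.
Qed.

Lemma adjoint_sym a b : opfam_adjoint a b -> opfam_adjoint b a.
Proof. by move=> ab u x y; rewrite dotC -ab -dotC. Qed.

Lemma adjointD a b a' b' : opfam_adjoint a b -> opfam_adjoint a' b' ->
  opfam_adjoint (opfamD a a') (opfamD b b').
Proof. by move=> ab ab' u x y; rewrite dotDl dotDr ab ab'. Qed.

Lemma adjointZ a b (c : R[i]) : opfam_adjoint a b ->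
  opfam_adjoint (opfamZ c a) (opfamZ (Num.conj c) b).
Proof. by move=> ab u x y; rewrite dotZl dotZr ab conjCK. Qed.

Lemma adjointM a b a' b' : opfam_adjoint a b -> opfam_adjoint a' b' ->
  opfam_adjoint (opfamM a a') (opfamM b' b).
Proof. by move=> ab ab' u x y; rewrite /opfamM ab ab'. Qed.

(** The squared norm of [b u x] is the inner product of [a u (b u x)] with [x]; Cauchy-Schwarz
    bounds it, and one factor cancels. *)
Lemma adjoint_norm_le a b M : 0 <= M -> opfam_norm_le a M -> opfam_adjoint a b ->
  opfam_norm_le b M.
Proof.
move=> M0 aM ab u x.
have [b0|b0] := eqVneq (ell2_norm (b u x)) 0.
  by rewrite b0 mulr_ge0 ?ell2_norm_ge0.
have bp : 0 < ell2_norm (b u x) by rewrite lt_neqAle eq_sym b0 ell2_norm_ge0.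
rewrite -(ler_pM2r bp) -expr2.
have -> : ell2_norm (b u x) ^+ 2 = cabs (ell2_dot (a u (b u x)) x).
  by rewrite ab dot_self cabs_real ger0_norm ?sqr_ge0.
apply: le_trans (dot_le _ _) _; rewrite mulrAC ler_wpM2r ?ell2_norm_ge0//.
Qed.

Lemma adjoint_limit a b : (forall e, 0 < e -> exists a' b',
    [/\ opfam_adjoint a' b', opfam_dist_le a a' e & opfam_dist_le b b' e]) ->
  opfam_adjoint a b.
Proof.
move=> lim u x y; apply/eqP; rewrite -subr_eq0; apply/eqP/cabs0_eq/eqP.
rewrite eq_le cabs_ge0 andbT; apply/ler_addgt0Pr => e e0; rewrite add0r.
pose n := ell2_norm x * ell2_norm y.
have n0 : 0 <= n by rewrite mulr_ge0 ?ell2_norm_ge0.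
have k0 : 0 < 2 * n + 1 by lra.
have d0 : 0 < e / (2 * n + 1) by rewrite divr_gt0.
have : e / (2 * n + 1) * n + e / (2 * n + 1) * n <= e.
  have -> : e / (2 * n + 1) * n + e / (2 * n + 1) * n = e * (2 * n) / (2 * n + 1).
    by field; rewrite gt_eqF.
  by rewrite ler_pdivrMr// ler_wpM2l ?(ltW e0)// lerDl.
move: (e / (2 * n + 1)) d0 => d d0; apply: le_trans.
have [a' [b' [adj aa' bb']]] := lim _ d0.
have -> : ell2_dot (a u x) y - ell2_dot x (b u y) =
   ell2_dot (a u x - a' u x) y - ell2_dot x (b u y - b' u y).
  rewrite -[- a' u x]scaleN1r -[- b' u y]scaleN1r dotDl dotDr dotZl dotZr adj.
  by rewrite rmorphN rmorph1; ring.
apply: le_trans (cabsD _ _) _; rewrite cabsN.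
apply: lerD; apply: le_trans (dot_le _ _) _.
  by apply: le_trans (ler_wpM2r (ell2_norm_ge0 _) (aa' u x)) _; rewrite -mulrA.
apply: le_trans (ler_wpM2l (ell2_norm_ge0 _) (bb' u y)) _.
by rewrite mulrCA.
Qed.

End opfams.

(** * Completeness of l^2 and of the bounded operator families *)

Section completeness.
Context (R : realType).

Lemma real_cauchy (v : nat -> R) :
  (forall e, 0 < e -> exists N, forall n, (N <= n)%N -> `|v N - v n| <= e) ->
  exists l : R, v @ \oo --> l.
Proof.
move=> cv; suff /cauchy_cvgP cvg_v : cauchy (v @ \oo) by exists (lim (v @ \oo)).
apply: cauchy_exP => e e0; have [|N vN] := cv (e / 2); first by rewrite divr_gt0.
exists (v N), N => // n /= Nn; rewrite /ball /=.
by apply: le_lt_trans (vN n Nn) _; rewrite ltr_pdivrMr// ltr_pMr// ltr1n.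
Qed.

Lemma Re_le_cabs (z : R[i]) : `|complex.Re z| <= cabs z.
Proof.
rewrite -ler_sqr ?nnegrE ?normr_ge0 ?cabs_ge0// sqr_cabs real_normK ?num_real//.
by rewrite /normsq lerDl sqr_ge0.
Qed.

Lemma Im_le_cabs (z : R[i]) : `|complex.Im z| <= cabs z.
Proof.
rewrite -ler_sqr ?nnegrE ?normr_ge0 ?cabs_ge0// sqr_cabs real_normK ?num_real//.
by rewrite /normsq lerDr sqr_ge0.
Qed.

(* The limit is taken coordinatewise; Fatou for finite sums gives the bound. *)
Lemma ell2_complete (X : choiceType) (f : nat -> ell2 R X) (e : nat -> R) :
  (forall n m, (n <= m)%N -> ell2_norm (f n - f m) <= e n) ->
  (forall d, 0 < d -> exists n, e n <= d) ->
  exists l : ell2 R X, forall n, ell2_norm (f n - l) <= e n.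
Proof.
move=> fe e0.
have en n : 0 <= e n by apply: le_trans (fe n n (leqnn n)); exact: ell2_norm_ge0.
have lRe i : exists l : R, (fun n => complex.Re (f n i)) @ \oo --> l.
  apply: real_cauchy => d /e0[N eN]; exists N => n Nn.
  apply: le_trans (le_trans (fe N n Nn) eN); apply: le_trans (coord_le _ i).
  by rewrite ell2B_coord; apply: le_trans (Re_le_cabs _); rewrite raddfB.
have lIm i : exists l : R, (fun n => complex.Im (f n i)) @ \oo --> l.
  apply: real_cauchy => d /e0[N eN]; exists N => n Nn.
  apply: le_trans (le_trans (fe N n Nn) eN); apply: le_trans (coord_le _ i).
  by rewrite ell2B_coord; apply: le_trans (Im_le_cabs _); rewrite raddfB.
pose l i : R[i] := Complex (projT1 (cid (lRe i))) (projT1 (cid (lIm i))).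
have lR i : (fun n => complex.Re (f n i)) @ \oo --> complex.Re (l i).
  by rewrite /l /=; case: cid.
have lI i : (fun n => complex.Im (f n i)) @ \oo --> complex.Im (l i).
  by rewrite /l /=; case: (cid (lIm i)).
have bound n (s : seq X) : uniq s ->
    \sum_(i <- s) normsq (f n i - l i) <= e n ^+ 2.
  move=> us; pose F m := \sum_(i <- s) normsq (f n i - f m i).
  have cF : F @ \oo --> \sum_(i <- s) normsq (f n i - l i).
    rewrite /F; elim: s {us F} => [|i s IH].
      by under eq_fun do rewrite big_nil; rewrite big_nil; exact: cvg_cst.
    under eq_fun do rewrite big_cons; rewrite big_cons.
    apply: cvgD => //; rewrite /normsq; under eq_fun do rewrite !raddfB !expr2.
    rewrite !raddfB !expr2.
    by apply: cvgD; apply: cvgM; apply: cvgB;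
      first [exact: lR|exact: lI|exact: cvg_cst].
  apply: (cvgr_to_le cF); exists n => // m /= nm.
  apply: le_trans (sum_normsq_le (f n - f m) us) _.
  by rewrite ler_sqr ?nnegrE ?ell2_norm_ge0// fe.
(* The bound concerns [f 0 - l], which is therefore square summable; [l] is recovered as its
   difference from [f 0]. *)
have [y yE _] := ell2_of_bound (en 0%N) (bound 0%N).
exists (f 0%N - y) => n; apply: ell2_norm_le => // s us.
apply: le_trans (bound n s us).
rewrite le_eqVlt (_ : \sum_(i <- s) _ = \sum_(i <- s) normsq (f n i - l i)) ?eqxx//.
by apply: eq_bigr => i _; rewrite !ell2B_coord yE; congr normsq; ring.
Qed.

Context (G : topGroupoid).
Implicit Types (a b c : opfam R G).

Lemma opfam_complete (T : nat -> opfam R G) (e : nat -> R) :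
  (forall n, bounded_opfam (T n)) ->
  (forall n m, (n <= m)%N -> opfam_dist_le (T n) (T m) (e n)) ->
  (forall d, 0 < d -> exists n, e n <= d) ->
  exists2 L, bounded_opfam L & forall n, opfam_dist_le (T n) L (e n).
Proof.
move=> Tb Te e0.
have ex u x : exists l, forall n, ell2_norm (T n u x - l) <= e n * ell2_norm x.
  apply: ell2_complete => [n m nm|d d0]; first exact: Te.
  have [|n en] := e0 (d / (ell2_norm x + 1)).
    by rewrite divr_gt0// ltr_wpDl ?ell2_norm_ge0.
  exists n; apply: le_trans (ler_wpM2r (ell2_norm_ge0 x) en) _.
  rewrite mulrAC ler_pdivrMr ?ltr_wpDl ?ell2_norm_ge0//.
  by rewrite ler_wpM2l ?(ltW d0)// lerDl.
pose L : opfam R G := fun u x => projT1 (cid (ex u x)).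
have TL n : opfam_dist_le (T n) L (e n).
  by move=> u x; rewrite /L; case: cid.
exists L => //; split; last first.
  have [M bM] := bounded_op_bound (Tb 0%N).
  by exists (M + e 0%N); exact: dist_norm_le bM (TL 0%N).
move=> u c x y; apply/eqP; rewrite -subr_eq0; apply/eqP/ell2_norm0_eq/eqP.
rewrite eq_le ell2_norm_ge0 andbT; apply/ler_addgt0Pr => d d0; rewrite add0r.
pose K := ell2_norm (c *: x + y) + cabs c * ell2_norm x + ell2_norm y.
have K0 : 0 <= K by rewrite !addr_ge0 ?mulr_ge0 ?ell2_norm_ge0 ?cabs_ge0.
have [|n en] := e0 (d / (K + 1)); first by rewrite divr_gt0// ltr_wpDl.
have Tlin := (Tb n).1 u c x y.
have -> : L u (c *: x + y) - (c *: L u x + L u y) =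
   - (T n u (c *: x + y) - L u (c *: x + y)) +
   (c *: (T n u x - L u x) + (T n u y - L u y)).
  apply/ell2P => i; rewrite Tlin.
  by rewrite !(ell2D_coord, ell2N_coord, ell2Z_coord); ring.
apply: (@le_trans _ _ (e n * K)).
  have -> : e n * K = e n * ell2_norm (c *: x + y) +
     (cabs c * (e n * ell2_norm x) + e n * ell2_norm y) by rewrite /K; ring.
  apply: le_trans (ell2_normD _ _) (lerD _ _).
    by rewrite ell2_normN; exact: TL.
  apply: le_trans (ell2_normD _ _) (lerD _ _); last exact: TL.
  apply: le_trans (ell2_normZ_le _ _) _.
  by apply: ler_wpM2l; [exact: cabs_ge0|exact: TL].
apply: le_trans (ler_wpM2r K0 en) _.
rewrite mulrAC ler_pdivrMr ?ltr_wpDl//.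
by rewrite ler_wpM2l ?(ltW d0)// lerDl.
Qed.

End completeness.

(** * Norm closures of sets of operator families *)

Section closure.
Context (R : realType) (G : topGroupoid).
Implicit Types (a b c : opfam R G) (S : set (opfam R G)).

Lemma closureD S a b :
  (forall a b, S a -> S b -> S (opfamD a b)) ->
  opfam_closure S a -> opfam_closure S b -> opfam_closure S (opfamD a b).
Proof.
move=> SD [ab aS] [bb bS]; split.
  have [M aM] := bounded_op_bound ab; have [N bN] := bounded_op_bound bb.
  exact: op_bound_bounded (op_boundD aM bN).
move=> e e0; have e2 : 0 < e / 2 by rewrite divr_gt0.
have [a' Sa' aa'] := aS _ e2; have [b' Sb' bb'] := bS _ e2.
exists (opfamD a' b'); first exact: SD.
by rewrite (splitr e); exact: distD.
Qed.

Lemma closureZ S a (c : R[i]) :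
  (forall a, S a -> S (opfamZ c a)) ->
  opfam_closure S a -> opfam_closure S (opfamZ c a).
Proof.
move=> SZ [ab aS]; split.
  by have [M aM] := bounded_op_bound ab; exact: op_bound_bounded (op_boundZ c aM).
move=> e e0; have [|a' Sa' aa'] := aS (e / (cabs c + 1)).
  by rewrite divr_gt0// ltr_wpDl ?cabs_ge0.
exists (opfamZ c a'); first exact: SZ.
apply: norm_leW (distZ c aa').
rewrite mulrA ler_pdivrMr ?ltr_wpDl ?cabs_ge0// mulrC.
by rewrite ler_wpM2l ?(ltW e0)// lerDl.
Qed.

Lemma closureM S a b :
  (forall a b, S a -> S b -> S (opfamM a b)) ->
  opfam_closure S a -> opfam_closure S b -> opfam_closure S (opfamM a b).
Proof.
move=> SM [ab aS] [bb bS].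
have [M aM] := bounded_op_bound ab; have [N bN] := bounded_op_bound bb.
split; first exact: op_bound_bounded (op_boundM aM bN).
move=> e e0; pose K := M + N + 1.
have M0 : 0 <= M by case: aM.
have N0 : 0 <= N by case: bN.
have K0 : 0 < K by rewrite /K; lra.
(* The error of the product is [M * d + d * (N + d)]; with [d <= 1] it is at most [d * K]. *)
pose d := Num.min 1 (e / K).
have d0 : 0 < d by rewrite lt_min ltr01 divr_gt0.
have d1 : d <= 1 by rewrite ge_min lexx.
have de : d * K <= e by rewrite -ler_pdivlMr// ge_min lexx orbT.
have [a' Sa' aa'] := aS _ d0; have [b' Sb' bb'] := bS _ d0.
exists (opfamM a' b'); first exact: SM.
apply: norm_leW (distM aM (dist_norm_le bN bb') (ltW d0) aa' bb').
apply: le_trans de; rewrite /K.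
by have := ler_wpM2l (ltW d0) d1; rewrite mulr1 => ?; nra.
Qed.

Lemma closure_limit S a : bounded_opfam a ->
  (forall e, 0 < e -> exists2 b, opfam_closure S b & opfam_dist_le a b e) ->
  opfam_closure S a.
Proof.
move=> ab aS; split => // e e0; have e2 : 0 < e / 2 by rewrite divr_gt0.
have [b [_ bS] ab'] := aS _ e2; have [c Sc bc] := bS _ e2.
by exists c => //; rewrite (splitr e); exact: dist_tri bc.
Qed.

Lemma inv_succ_small (d : R) : 0 < d -> exists n, 2 * n.+1%:R^-1 <= d.
Proof.
move=> d0; exists (Num.truncn (2 / d)).
by rewrite ler_pdivrMr ?ltr0n// mulrC -ler_pdivrMr// ltW// truncnS_gt.
Qed.

(** The adjoint is found as a limit: passing to adjoints preserves norm bounds, so the adjoints of a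
    sequence in [S] approximating [a] form a Cauchy sequence. *)
Lemma closure_adjoint S a :
  (forall b, S b -> bounded_opfam b) ->
  (forall b, S b -> exists2 b', S b' & opfam_adjoint b b') ->
  opfam_closure S a -> exists2 a', opfam_closure S a' & opfam_adjoint a a'.
Proof.
move=> Sb Sadj [ab aS].
have ex n : exists2 p : opfam R G * opfam R G, [/\ S p.1, S p.2 &
    opfam_adjoint p.1 p.2] & opfam_dist_le a p.1 n.+1%:R^-1.
  have [|b bS ab'] := aS n.+1%:R^-1; first by rewrite invr_gt0.
  by have [b' b'S adj] := Sadj b bS; exists (b, b').
pose p n := projT1 (cid2 (ex n)).
have pP n : [/\ S (p n).1, S (p n).2 & opfam_adjoint (p n).1 (p n).2].
  by rewrite /p; case: cid2.
have pa n : opfam_dist_le a (p n).1 n.+1%:R^-1 by rewrite /p; case: cid2.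
have dist n m : (n <= m)%N -> opfam_dist_le (p n).2 (p m).2 (2 * n.+1%:R^-1).
  move=> nm.
  have adj : opfam_adjoint (opfamD (p n).1 (opfamZ (-1) (p m).1))
     (opfamD (p n).2 (opfamZ (-1) (p m).2)).
    apply: adjointD; first by have [] := pP n.
    have := adjointZ (-1) (let: And3 _ _ h := pP m in h).
    by rewrite rmorphN rmorph1.
  have le : opfam_norm_le (opfamD (p n).1 (opfamZ (-1) (p m).1)) (2 * n.+1%:R^-1).
    move=> u x; rewrite /opfamD /opfamZ scaleN1r mulr_natl mulr2n.
    apply: (@norm_leW _ _ (fun u x => (p n).1 u x - (p m).1 u x)
      (n.+1%:R^-1 + m.+1%:R^-1)).
      by rewrite lerD2l lef_pV2 ?posrE// ler_nat ltnS.
    exact: dist_tri (dist_sym (pa n)) (pa m).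
  move=> u x; have := adjoint_norm_le _ le adj.
  rewrite /opfam_norm_le /opfamD /opfamZ => /(_ _ u x); rewrite scaleN1r.
  by apply; rewrite mulr_ge0.
have [n|d d0|L Lb pL] := opfam_complete _ dist.
- by have [_ /Sb] := pP n.
- exact: inv_succ_small.
have small d : 0 < d -> exists n, 2 * n.+1%:R^-1 <= d :> R := @inv_succ_small d.
exists L.
  split => // e /small[n ne]; exists (p n).2; first by have [] := pP n.
  exact: norm_leW ne (dist_sym (pL n)).
apply: adjoint_limit => e /small[n ne]; exists (p n).1, (p n).2; split.
- by have [] := pP n.
- apply: norm_leW (pa n); apply: le_trans ne.
  by rewrite ler_peMl// ler1n.
- exact: norm_leW ne (dist_sym (pL n)).
Qed.

End closure.

(** * Boundedness of *-homomorphisms *)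

Section cstar_algebra.
Context (R : realType) (B : cstarAlgType R).
Implicit Types x y z : B.

Lemma cmulr0 x : cmul x 0 = 0.
Proof. by have := cmulZr (0 : R[i]) x 0; rewrite !scale0r. Qed.

Lemma cmulNl x y : cmul (- x) y = - cmul x y.
Proof. by rewrite -scaleN1r cmulZl scaleN1r. Qed.

Lemma cmulNr x y : cmul x (- y) = - cmul x y.
Proof. by rewrite -scaleN1r cmulZr scaleN1r. Qed.

Lemma cstarN x : cstar (- x) = - cstar x.
Proof. by rewrite -scaleN1r cstarZ rmorphN rmorph1 scaleN1r. Qed.

(** By the C*-identity: the cross terms are [i] times the difference of the two sides of the first
    equation on [p] and [q], hence cancel. Leaving [i] general covers both a unitary and its
    adjoint. *)
Lemma norm_isometry z (p q : B) (i : R[i]) : i * i = -1 -> Num.conj i = - i ->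
  cmul (cstar p) q = cmul (cstar q) p ->
  cmul (cstar p) p + cmul (cstar q) q = cmul (cstar z) z ->
  `|p + i *: q| = `|z|.
Proof.
move=> ii ci pq ppqq; apply/eqP.
rewrite -(@eqrXn2 _ 2)// -!cnorm_star cstarD cstarZ cmulDl !cmulDr.
rewrite !cmulZl !cmulZr scalerA ci mulNr ii opprK scale1r pq scaleNr.
by rewrite addrA -(addrA _ (i *: _)) subrr addr0 ppqq.
Qed.

(* With [V = X + i (1 - Y)] in the unitization, the hypotheses say that [V] is
   unitary, and [X] is the average of [V] and its adjoint. *)
Lemma norm_le1_of_fixed_point x y : cstar x = x -> cstar y = y ->
  cmul x y = cmul y x -> y = (2^-1 : R[i]) *: (cmul x x + cmul y y) -> `|x| <= 1.
Proof.
move=> xs ys xy yE.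
have y2 : y + y = cmul x x + cmul y y.
  by rewrite {1 2}yE -scalerDl -[RHS]scale1r; congr (_ *: _); field.
(* Since [B] need not have a unit, [V] is only available through its products [V z], with real part
   [cmul x z] and imaginary part [z - cmul y z]. *)
have half z : `|cmul x z| <= `|z|.
  have pq : cmul (cstar (cmul x z)) (z - cmul y z) =
            cmul (cstar (z - cmul y z)) (cmul x z).
    rewrite cstarD cstarN !cstarM xs ys cmulDr cmulDl cmulNr cmulNl.
    by rewrite -!cmulA !(cmulA x) !(cmulA y) xy.
  have ppqq : cmul (cstar (cmul x z)) (cmul x z) +
     cmul (cstar (z - cmul y z)) (z - cmul y z) = cmul (cstar z) z.
    rewrite cstarD cstarN !cstarM xs ys !(cmulDr, cmulDl) !(cmulNl, cmulNr).
    rewrite opprK -!cmulA !(cmulA x) !(cmulA y).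
    have -> : cmul (cmul x x) z = cmul y z + cmul y z - cmul (cmul y y) z.
      by rewrite -cmulDl y2 cmulDl addrK.
    rewrite !(cmulDr, cmulNr).
    set a := cmul (cstar z) (cmul y z); set b := cmul _ (cmul (cmul y y) z).
    set c := cmul (cstar z) z.
    have -> : c - a + (- a + b) = c - (a + a - b).
      by rewrite !opprD opprK !addrA.
    by rewrite addrC subrK.
  have iN : 'i%C * 'i%C = -1 :> R[i] by rewrite -expr2 sqr_i.
  have V : `|cmul x z + 'i%C *: (z - cmul y z)| = `|z|.
    by apply: norm_isometry => //; rewrite conjCi.
  have W : `|cmul x z + (- 'i%C) *: (z - cmul y z)| = `|z|.
    apply: norm_isometry => //; first by rewrite mulrNN.
    by rewrite rmorphN /= conjCi.
  have : `|cmul x z + cmul x z| <= `|z| + `|z|.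
    rewrite -{1}V -W; apply: le_trans (ler_normD _ _).
    by rewrite scaleNr addrACA subrr addr0.
  by rewrite -mulr2n -mulr2n normrMn lerMn2r.
(* With [z = x] the C*-identity gives |x|^2 <= |x|. *)
have := half x; rewrite -{1}xs cnorm_star expr2.
have [->|x0] := eqVneq x 0; first by rewrite normr0 ler01.
by rewrite ger_pMl ?normr_gt0.
Qed.

End cstar_algebra.

Section contraction.
Context (R : realType) (G : topGroupoid) (B : cstarAlgType R).
Implicit Types (a b x y : opfam R G) (A : set (opfam R G)).

(** A norm-closed, self-adjoint algebra of operator families, kept abstract so that the fixed-point
    argument is independent of groupoids' convolution. *)
Record concrete_cstar A : Prop := ConcreteCstar {
  ccb : forall a, A a -> bounded_opfam a;
  ccD : forall a b, A a -> A b -> A (opfamD a b);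
  ccZ : forall c a, A a -> A (opfamZ c a);
  ccM : forall a b, A a -> A b -> A (opfamM a b);
  cclim : forall a, bounded_opfam a ->
    (forall e, 0 < e -> exists2 b, A b & opfam_dist_le a b e) -> A a;
  ccadj : forall a, A a -> exists2 b, A b & opfam_adjoint a b
}.

Record star_hom_on A (rho : opfam R G -> B) : Prop := StarHomOn {
  shD : forall a b, A a -> A b -> rho (opfamD a b) = rho a + rho b;
  shZ : forall c a, A a -> rho (opfamZ c a) = c *: rho a;
  shM : forall a b, A a -> A b -> rho (opfamM a b) = cmul (rho a) (rho b);
  shadj : forall a b, A a -> A b -> opfam_adjoint a b -> rho b = cstar (rho a)
}.

Definition half_sqsum x y : opfam R G :=
  opfamZ (2^-1)%:C%C (opfamD (opfamM x x) (opfamM y y)).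

Lemma cabs_half : cabs ((2^-1 : R)%:C%C) = 2^-1.
Proof. by rewrite cabs_real ger0_norm. Qed.

Lemma half_sqsum_comm x y : (forall u, linear (x u)) -> (forall u, linear (y u)) ->
  opfamM x y = opfamM y x -> opfamM x (half_sqsum x y) = opfamM (half_sqsum x y) x.
Proof.
move=> xl yl xy.
have E u v : x u (y u v) = y u (x u v).
  by have := congr1 (fun f : opfam R G => f u v) xy.
apply: functional_extensionality_dep => u; apply/funext => v.
by rewrite /half_sqsum /opfamM /opfamZ /opfamD (opZ xl) (opD xl) !E.
Qed.

(* The solution [y] of [2 y = x^2 + y^2] is found by a contracting iteration. *)
Lemma half_sqsum_fixed_point A x : concrete_cstar A -> A x -> op_bound x (2^-1) ->
  opfam_adjoint x x -> exists y, [/\ A y, opfam_adjoint y y,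
    opfamM x y = opfamM y x & y = half_sqsum x y].
Proof.
move=> cA Ax xb xx; pose f n := iter n (half_sqsum x) (@opfam0 R G).
have xl : forall u, linear (x u) by case: xb.
(* Membership of the zero family in [A] comes from scaling [x]. *)
have f0 : f 0%N = opfamZ 0 x.
  apply: functional_extensionality_dep => u; apply/funext => v.
  by rewrite /opfamZ scale0r.
have fA n : A (f n).
  elim: n => [|n IH]; first by rewrite f0; exact: (ccZ cA).
  by apply: (ccZ cA); apply: (ccD cA); apply: (ccM cA).
(* The ball of radius 1/4 is preserved, since (1/4 + 1/16) / 2 = 5/32. *)
have fb n : op_bound (f n) 4^-1.
  elim: n => [|n IH].
    have [zl _ zb] := @op_bound0 R G.
    by split; [|rewrite invr_ge0|apply: norm_leW zb; rewrite invr_ge0].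
  have [l m b] := op_boundZ (2^-1)%:C%C
    (op_boundD (op_boundM xb xb) (op_boundM IH IH)).
  by split => //; apply: norm_leW b; rewrite cabs_half; lra.
have fl n : forall u, linear (f n u) by case: (fb n).
have fadj n : opfam_adjoint (f n) (f n).
  elim: n => [|n IH].
    by rewrite f0; have := adjointZ 0 xx; rewrite rmorph0.
  have := adjointZ (2^-1)%:C%C (adjointD (adjointM xx xx) (adjointM IH IH)).
  by rewrite conj_real.
have fx n : opfamM x (f n) = opfamM (f n) x.
  elim: n => [|n IH]; last exact: half_sqsum_comm.
  apply: functional_extensionality_dep => u; apply/funext => v.
  by rewrite /opfamM /f /= /opfam0 (op0 xl).
have dxx a : opfam_dist_le a a 0 by move=> u v; rewrite subrr mul0r ell2_norm0.
(* Half of 1/4 + 1/2, the bounds on the two arguments of [step]. The second argument is allowed norm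
   1/2 because it will also be the limit [y], for which only 1/4 + 1/4 is established. *)
pose q : R := 3 / 8.
have q0 : 0 <= q by rewrite /q; lra.
have step a b e : op_bound a 4^-1 -> opfam_norm_le b (2^-1) -> 0 <= e ->
    opfam_dist_le a b e -> opfam_dist_le (half_sqsum x a) (half_sqsum x b) (q * e).
  move=> ab bb e0 dab; have := distM ab bb e0 dab dab.
  move=> /(distD (dxx (opfamM x x)))/(distZ (2^-1)%:C%C); apply: norm_leW.
  by rewrite cabs_half add0r /q; lra.
have fdist n k : opfam_dist_le (f n) (f (n + k)%N) (q ^+ n).
  elim: n => [|n IH].
    move=> u v; rewrite /f /= /opfam0 sub0r ell2_normN expr0.
    case: (fb k) => _ _ /(_ u v)/le_trans; apply.
    by rewrite ler_wpM2r ?ell2_norm_ge0// invf_le1// ler1n.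
  rewrite addSn /= exprS; apply: step => //; last exact: exprn_ge0.
  by case: (fb (n + k)%N) => _ _; apply: norm_leW; lra.
have q_small (d : R) : 0 < d -> exists n, q ^+ n <= d.
  move=> d0; have [n nd] := inv_succ_small d0; exists n.+1; apply: le_trans nd.
  apply: (@le_trans _ _ n.+1%:R^-1); last by rewrite ler_peMl// ler1n.
  apply: (@le_trans _ _ (2^-1 ^+ n.+1)).
    by rewrite lerXn2r ?nnegrE ?invr_ge0// /q; lra.
  rewrite exprVn lef_pV2 ?posrE ?exprn_gt0// -natrX ler_nat.
  by rewrite ltnW// ltn_expl.
have [n|n m nm|y yb yd] := opfam_complete _ _ q_small (T := f).
- exact: op_bound_bounded (fb n).
- by rewrite -(subnKC nm).
have approx (e : R) : 0 < e -> exists2 n, opfam_dist_le y (f n) e &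
    opfam_dist_le y (f n.+1) e.
  move=> /q_small[n ne]; exists n; apply: dist_sym.
    exact: norm_leW ne (yd n).
  apply: norm_leW (yd n.+1); apply: le_trans ne.
  by rewrite exprS ler_piMl ?exprn_ge0// /q; lra.
have yl : forall u, linear (y u) by case: yb.
have yn : opfam_norm_le y (2^-1).
  have q4 : 0 < 4^-1 :> R by rewrite invr_gt0.
  have [n yn _] := approx _ q4.
  by apply: norm_leW (dist_norm_le (fb n) (dist_sym yn)); lra.
have xn : opfam_norm_le x (2^-1) by case: xb.
exists y; split.
- by apply: (cclim cA) => // e /approx[n yn' _]; exists (f n).
- apply: adjoint_limit => e /approx[n yn' _].
  by exists (f n), (f n); split.
- apply: dist_eq => e e0; have [n yn' _] := approx _ e0.
  have d1 := distM xb yn (lexx 0) (dxx x) (dist_sym yn').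
  have d2 := distM (fb n) xn (ltW e0) (dist_sym yn') (dxx x).
  rewrite -fx in d2; apply: norm_leW (dist_tri (dist_sym d1) d2); lra.
- apply: dist_eq => e e0; have [|n y1 y2] := approx (e / 2).
    by rewrite divr_gt0.
  have e2 : 0 <= e / 2 by rewrite divr_ge0// ltW.
  apply: norm_leW (dist_tri y2 (step _ _ _ (fb n) yn e2 (dist_sym y1))).
  by rewrite /q; lra.
Qed.

Context (A : set (opfam R G)) (cA : concrete_cstar A)
        (rho : opfam R G -> B) (hrho : star_hom_on A rho).

Lemma selfadjoint_contraction x : A x -> op_bound x (2^-1) -> opfam_adjoint x x ->
  `|rho x| <= 1.
Proof.
move=> Ax xb xx; have [y [Ay yy xy yE]] := half_sqsum_fixed_point cA Ax xb xx.
apply: (@norm_le1_of_fixed_point _ _ (rho x) (rho y)).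
- by rewrite -(shadj hrho Ax Ax xx).
- by rewrite -(shadj hrho Ay Ay yy).
- by rewrite -!(shM hrho)// xy.
- have AxA := ccM cA Ax Ax; have AyA := ccM cA Ay Ay.
  apply: etrans (congr1 rho yE) _; rewrite /half_sqsum.
  rewrite (shZ hrho _ (ccD cA AxA AyA)) (shD hrho AxA AyA).
  by rewrite (shM hrho Ax Ax) (shM hrho Ay Ay) fmorphV rmorph_nat.
Qed.

Lemma selfadjoint_bound x (M : R) : 0 < M -> A x -> opfam_norm_le x M ->
  opfam_adjoint x x -> `|rho x| <= (2 * M)%:C%C.
Proof.
move=> M0 Ax xM xx; pose r : R := (2 * M)^-1.
have M2 : 0 < 2 * M by rewrite mulr_gt0.
have r0 : 0 < r by rewrite invr_gt0.
have xb : op_bound x M by split; [case: (ccb cA Ax)|exact: ltW|].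
have rx : op_bound (opfamZ r%:C%C x) 2^-1.
  have [l _ b] := op_boundZ r%:C%C xb; split; rewrite ?invr_ge0//.
  apply: norm_leW b; rewrite cabs_real gtr0_norm// /r invfM mulrAC -mulrA.
  by rewrite divff ?gt_eqF// mulr1.
have rxx : opfam_adjoint (opfamZ r%:C%C x) (opfamZ r%:C%C x).
  by have := adjointZ r%:C%C xx; rewrite conj_real.
have := selfadjoint_contraction (ccZ cA _ Ax) rx rxx.
rewrite (shZ hrho)// normrZ cabsE cabs_real gtr0_norm// /r fmorphV.
by rewrite mulrC ler_pdivrMr ?mul1r// ltcR.
Qed.

(** The C*-identity reduces the claim to the product of the adjoint of [x] with [x], which is
    self-adjoint of norm at most [M * M]; hence |rho x|^2 <= 2 M^2. The constant 2 goes back to the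
    condition |x| <= 1/2 in the fixed-point argument. *)
Lemma star_hom_bound x (M : R) : 0 < M -> A x -> opfam_norm_le x M ->
  `|rho x| <= (2 * M)%:C%C.
Proof.
move=> M0 Ax xM; have [y Ay xy] := ccadj cA Ax.
have yM := adjoint_norm_le (ltW M0) xM xy.
have yb : op_bound y M by split; [case: (ccb cA Ay)|exact: ltW|].
have xb : op_bound x M by split; [case: (ccb cA Ax)|exact: ltW|].
have [_ _ yxM] := op_boundM yb xb.
have MM : 0 < M * M by rewrite mulr_gt0.
have := selfadjoint_bound MM (ccM cA Ay Ax) yxM (adjointM (adjoint_sym xy) xy).
rewrite (shM hrho)// (shadj hrho Ax Ay xy) cnorm_star => le.
have M20 : 0 <= (2 * M)%:C%C :> R[i] by rewrite lecR mulr_ge0// ltW.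
rewrite -(@ler_pXn2r _ 2)// ?nnegrE ?normr_ge0//.
apply: le_trans le _; rewrite -rmorphXn lecR.
by nra.
Qed.

End contraction.

(** * Open bisections *)

Section bisections.
Context (G : topGroupoid).
Implicit Types (a b c : G) (U V : set G) (v : gunits G).

Lemma ginvK : involutive (@ginv G).
Proof.
move=> a.
have e1 : gsrc (ginv (ginv a)) = grng (ginv a) by rewrite gsrcV.
have e2 : gsrc (ginv a) = grng a by rewrite gsrcV.
rewrite -[LHS]gmulg1 e1 grngV -gmulVg gmulA// gmulVg e2.
by rewrite gmul1g.
Qed.

Lemma gmulVKg a b : gsrc a = grng b -> gmul (ginv a) (gmul a b) = b.
Proof. by move=> ab; rewrite gmulA// ?gsrcV// gmulVg ab gmul1g. Qed.

Lemma gmulKVg a b : grng a = grng b -> gmul a (gmul (ginv a) b) = b.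
Proof.
by move=> ab; rewrite gmulA ?grngV ?gsrcV// gmulgV ab gmul1g.
Qed.

Lemma gmulgK a b : gsrc a = grng b -> gmul (gmul a b) (ginv b) = a.
Proof. by move=> ab; rewrite -gmulA ?grngV// gmulgV -ab gmulg1. Qed.

Lemma gmulgKV a b : gsrc a = gsrc b -> gmul (gmul a (ginv b)) b = a.
Proof. by move=> ab; rewrite -gmulA ?grngV ?gsrcV// gmulVg -ab gmulg1. Qed.

Lemma ginvM a b : gsrc a = grng b -> ginv (gmul a b) = gmul (ginv b) (ginv a).
Proof.
move=> ab.
have e1 : gsrc (ginv b) = grng (ginv a) by rewrite gsrcV grngV ab.
have e2 : gsrc (gmul (ginv b) (ginv a)) = grng (gmul a b).
  by rewrite gsrcM// gsrcV grngM.
have e3 : gmul (gmul (ginv b) (ginv a)) (gmul a b) = gunit (gsrc b).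
  by rewrite -(gmulA e1) ?gsrcV ?grngM// gmulVKg// gmulVg.
rewrite -[LHS]gmul1g grngV gsrcM// -e3 -gmulA ?grngV// gmulgV -e2.
by rewrite gmulg1.
Qed.

Lemma ginv_unit v : ginv (gunit v) = gunit v.
Proof.
have := gmulVg (gunit v); have := gmulg1 (ginv (gunit v)).
by rewrite gsrcV grng_unit gsrc_unit => -> ->.
Qed.

Lemma cvg_gmul (T : Type) (F : set_system T) (FF : Filter F) (f g : T -> G) a b :
  gsrc a = grng b -> f @ F --> a -> g @ F --> b ->
  (\forall x \near F, gsrc (f x) = grng (g x)) ->
  (fun x => gmul (f x) (g x)) @ F --> gmul a b.
Proof.
move=> ab fa gb fg.
have /subspace_continuousP/(_ (a, b) ab) := @gmul_continuous G.
move=> cm; apply: (@cvg_comp _ _ _ (fun x => (f x, g x)) _ _ _ _ _ cm).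
move=> Q nQ.
have /(_ _ nQ) : (fun x => (f x, g x)) @ F --> (a, b) by exact: cvg_pair.
by apply: (filterS2 _ _ fg) => x fgx; exact.
Qed.

(* The values of [s] outside [f @` U] are irrelevant. *)
Definition local_section (f : G -> gunits G) U (s : gunits G -> G) :=
  [/\ open (f @` U), forall a, U a -> s (f a) = a & forall a, U a -> s @ f a --> a].

(** On an open image, continuity within the subspace is continuity at each point, a form that
    composes directly with other limits. *)
Lemma homeo_local_section (f : G -> gunits G) U : continuous f ->
  homeo_onto_open U f <-> exists s, local_section f U s.
Proof.
move=> cf; split.
  move=> [oU _ [g [cg fK]]]; exists g; split => // [a Ua|a Ua].
    exact/fK/mem_set.
  have fUa : (f @` U) (f a) by exists a.
  have := cg; rewrite continuous_open_subspace// => /(_ (f a)).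
  by move=> /(_ (mem_set fUa)); rewrite /continuous_at fK//; exact: mem_set.
move=> [s [oU sK cs]]; split => //; first exact: continuous_subspaceT.
exists s; split; last by move=> a /set_mem/sK.
rewrite continuous_open_subspace// => v /set_mem[a Ua <-].
by rewrite /continuous_at sK//; exact: cs.
Qed.

Lemma open_bisectionP U : open_bisection U <->
  [/\ open U, exists s, local_section (@grng G) U s &
      exists s, local_section (@gsrc G) U s].
Proof.
by split=> -[oU /(homeo_local_section _ (@grng_continuous G)) ?
  /(homeo_local_section _ (@gsrc_continuous G)) ?].
Qed.

Lemma bisection_open U : open_bisection U -> open U. Proof. by case. Qed.

Lemma bisection_rng_inj U a b : open_bisection U -> U a -> U b ->
  grng a = grng b -> a = b.
Proof.
by move=> /open_bisectionP[_ [s [_ sK _]] _] Ua Ub ab; rewrite -(sK a)// ab sK.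
Qed.

Lemma bisection_src_inj U a b : open_bisection U -> U a -> U b ->
  gsrc a = gsrc b -> a = b.
Proof.
by move=> /open_bisectionP[_ _ [s [_ sK _]]] Ua Ub ab; rewrite -(sK a)// ab sK.
Qed.

(** The image of [V] is open because near [f a] the section of [U] takes its values in [V]. *)
Lemma open_bisectionW U V : open_bisection U -> open V -> V `<=` U ->
  open_bisection V.
Proof.
have sub f : continuous f -> open V -> V `<=` U ->
    (exists s, local_section f U s) -> exists s, local_section f V s.
  move=> cf oV VU [s [oU sK cs]]; exists s; split => [|a /VU/sK//|a /VU/cs//].
  rewrite openE => _ [a Va <-].
  have nVs : \forall v \near f a, V (s v).
    by apply: (cs a (VU _ Va)); exact: open_nbhs_nbhs.
  have nU : nbhs (f a) (f @` U).
    by apply: open_nbhs_nbhs; split => //; exists a => //; exact: VU.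
  rewrite /interior; apply: filterS2 nVs nU => v Vs [b Ub bv].
  by exists b => //; rewrite -(sK b Ub) bv.
move=> /open_bisectionP[oU sr ss] oV VU; apply/open_bisectionP; split => //.
  exact: (sub _ (@grng_continuous G)).
exact: (sub _ (@gsrc_continuous G)).
Qed.

Definition gsetV U : set G := @ginv G @^-1` U.

Lemma gsetV_bisection U : open_bisection U -> open_bisection (gsetV U).
Proof.
have sub f g : (forall a, f (ginv a) = g a) ->
    (exists s, local_section g U s) -> exists s, local_section f (gsetV U) s.
  move=> fg [s [oU sK cs]].
  have gf a : g (ginv a) = f a by rewrite -fg ginvK.
  exists (fun v => ginv (s v)); split => [|a Ua|a Ua].
  - rewrite (_ : f @` _ = g @` U)//; apply/seteqP; split => _ [a Ua <-].
      by exists (ginv a).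
    by exists (ginv a); rewrite /gsetV /= ?ginvK.
  - by rewrite -gf sK// ginvK.
  - rewrite -gf -{2}(ginvK a); apply: continuous_cvg; last exact: cs.
    exact: ginv_continuous.
move=> /open_bisectionP[oU sr ss]; apply/open_bisectionP; split.
- by apply: open_comp => // a _; exact: ginv_continuous.
- exact: (sub _ _ (@grngV G)).
- exact: (sub _ _ (@gsrcV G)).
Qed.

Definition gsetM U V : set G := [set c | exists a b,
  [/\ U a, V b, gsrc a = grng b & c = gmul a b]].

Lemma gsetMV U V : gsetV (gsetM U V) = gsetM (gsetV V) (gsetV U).
Proof.
apply/seteqP; split => c [a [b [Ua Vb ab cE]]].
  exists (ginv b), (ginv a); rewrite /gsetV /= !ginvK gsrcV grngV; split => //.
  by rewrite -ginvM// -cE ginvK.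
exists (ginv b), (ginv a); rewrite gsrcV grngV; split => //.
by rewrite cE ginvM.
Qed.

(** The first factor of an arrow [c] in a product of bisections is determined by the range of [c],
    as [s (grng c)], so the second is [ginv (s (grng c))] times [c]. Its continuity yields both the
    openness of products and the continuity of convolutions. *)
Lemma cvg_gsetM_factor U s a b : local_section (@grng G) U s -> U a ->
  gsrc a = grng b ->
  (fun c => gmul (ginv (s (grng c))) c) @ gmul a b --> b.
Proof.
move=> [oU sK cs] Ua ab.
have srab : s @ grng (gmul a b) --> a by rewrite grngM//; exact: cs.
have cr : (fun c => s (grng c)) @ gmul a b --> a.
  exact: (cvg_comp _ _ (@grng_continuous G (gmul a b)) srab).
rewrite -[X in _ --> X](gmulVKg ab); apply: cvg_gmul.
- by rewrite gsrcV grngM.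
- by apply: continuous_cvg cr; exact: ginv_continuous.
- exact: cvg_id.
- have nU : \forall c \near gmul a b, (@grng G @` U) (grng c).
    apply: grng_continuous; apply: open_nbhs_nbhs; split => //.
    by exists a => //; rewrite grngM.
  by apply: filterS nU => c [d Ud dc]; rewrite gsrcV -dc sK.
Qed.

Lemma gsetM_rng U V : open_bisection U -> open_bisection V ->
  open (gsetM U V) /\ exists s, local_section (@grng G) (gsetM U V) s.
Proof.
move=> /open_bisectionP[oU [s sP] _] /open_bisectionP[oV [t [otV tK ct]] _].
have [osU sK cs] := sP.
have nU a : U a -> \forall v \near grng a, (@grng G @` U) v.
  by move=> Ua; apply: open_nbhs_nbhs; split => //; exists a.
have nV a b : U a -> V b -> gsrc a = grng b ->
    \forall v \near grng a, (@grng G @` V) (gsrc (s v)).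
  move=> Ua Vb ab; have nb : nbhs (gsrc a) (@grng G @` V).
    by apply: open_nbhs_nbhs; split => //; exists b.
  exact: (cs a Ua _ (@gsrc_continuous G a _ nb)).
split.
  rewrite openE => _ [a [b [Ua Vb ab ->]]].
  have nb : \forall c \near gmul a b, V (gmul (ginv (s (grng c))) c).
    have nVb : nbhs b V by exact: open_nbhs_nbhs.
    exact: (cvg_gsetM_factor sP Ua ab nVb).
  have na : \forall c \near gmul a b, (@grng G @` U) (grng c).
    by apply: (@grng_continuous G (gmul a b)); rewrite grngM//; exact: nU.
  rewrite /interior; apply: filterS2 nb na => c Vc [d Ud dc].
  exists d, (gmul (ginv d) c); rewrite gmulKVg// grngM ?gsrcV// grngV; split => //.
  by rewrite -(sK d)// dc.
exists (fun v => gmul (s v) (t (gsrc (s v)))); split.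
- rewrite openE => _ [_ [a [b [Ua Vb ab ->]]] <-]; rewrite grngM//.
  rewrite /interior; apply: filterS2 (nU a Ua) (nV a b Ua Vb ab).
  move=> _ [d Ud <-]; rewrite sK// => -[e Ve ed].
  exists (gmul d e); last by rewrite grngM.
  by exists d, e.
- by move=> _ [a [b [Ua Vb ab ->]]]; rewrite grngM// sK// ab tK.
- move=> _ [a [b [Ua Vb ab ->]]]; rewrite grngM//; apply: cvg_gmul => //.
  + exact: cs.
  + have ctb : t @ gsrc a --> b by rewrite ab; exact: ct.
    exact: (cvg_comp _ _ (cvg_comp _ _ (cs a Ua) (@gsrc_continuous G a)) ctb).
  + by apply: filterS (nV a b Ua Vb ab) => v [e Ve ev]; rewrite -ev tK.
Qed.

(** Inversion exchanges range and source and reverses products, so the statement about sources is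
    [gsetM_rng] for the inverse bisections. *)
Lemma gsetM_bisection U V : open_bisection U -> open_bisection V ->
  open_bisection (gsetM U V).
Proof.
move=> bU bV; apply/open_bisectionP; have [oUV sUV] := gsetM_rng bU bV.
split => //.
have [_ [s [os sK cs]]] := gsetM_rng (gsetV_bisection bV) (gsetV_bisection bU).
rewrite -gsetMV in os sK cs.
exists (fun v => ginv (s v)); split.
- rewrite (_ : _ @` _ = @grng G @` gsetV (gsetM U V))//.
  apply/seteqP; split => _ [a UVa <-].
    by exists (ginv a); rewrite /gsetV /= ?ginvK ?grngV.
  by exists (ginv a); rewrite // gsrcV.
- by move=> a UVa; rewrite -grngV sK ?ginvK// /gsetV /= ginvK.
- move=> a UVa; rewrite -grngV -{2}(ginvK a); apply: continuous_cvg.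
    exact: ginv_continuous.
  by apply: cs; rewrite /gsetV /= ginvK.
Qed.

End bisections.

Lemma closed_equalizer (X Y : topologicalType) (f g : X -> Y) :
  hausdorff_space Y -> continuous f -> continuous g -> closed [set x | f x = g x].
Proof.
rewrite open_hausdorff => hY cf cg; rewrite -openC openE => x /= /eqP fgx.
have [[P Q] /= [/set_mem fP /set_mem gQ] [oP oQ /eqP PQ]] := hY _ _ fgx.
have nP : \forall y \near x, P (f y) by apply: (cf x); exact: open_nbhs_nbhs.
have nQ : \forall y \near x, Q (g y) by apply: (cg x); exact: open_nbhs_nbhs.
rewrite /interior; apply: filterS2 nP nQ => y Py Qy /= fgy.
by have : set0 (f y) by rewrite -PQ; split => //; rewrite fgy.
Qed.

Lemma continuous_cabs (R : realType) : continuous (@cabs R).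
Proof.
move=> z; apply/(@cvgrPdist_le _ _ _ _ (nbhs_filter z)) => e e0.
have e0' : 0 < e%:C%C :> R[i] by rewrite ltcR.
have : \forall w \near z, `|z - w| <= e%:C%C.
  exact: (cvgrPdist_le (FF := nbhs_filter z) id z).1 (@cvg_id _ (nbhs z)) _ e0'.
apply: filterS => w; rewrite cabsE lecR => zw.
have le a b : cabs a - cabs b <= cabs (a - b :> R[i]).
  by rewrite lerBlDr -{1}(subrK b a) cabsD.
apply: le_trans zw; rewrite ler_norml le andbT lerNl opprB.
by rewrite -(cabsN (z - w)) opprB le.
Qed.

(** * Compactly supported functions on bisections and their span *)

Section Cc.
Context (R : realType).

Lemma Cc_cvg (X : topologicalType) (U : set X) (f : X -> R[i]) x :
  open U -> Cc U f -> U x -> f @ x --> f x.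
Proof.
by move=> oU [+ _] Ux; rewrite continuous_open_subspace// => /(_ x (mem_set Ux)).
Qed.

Lemma Cc_intro (X : topologicalType) (U K : set X) (f : X -> R[i]) : open U ->
  (forall x, U x -> f @ x --> f x) -> K `<=` U -> compact K ->
  (forall x, ~ K x -> f x = 0) -> Cc U f.
Proof.
move=> oU cf KU cK f0; split; last by exists K.
by rewrite continuous_open_subspace// => x /set_mem; exact: cf.
Qed.

Lemma Cc_out (X : topologicalType) (U : set X) (f : X -> R[i]) x :
  Cc U f -> ~ U x -> f x = 0.
Proof. by move=> [_ [K [KU _ f0]]] nU; apply: f0 => /KU. Qed.

Lemma Cc_bounded (X : topologicalType) (U : set X) (f : X -> R[i]) :
  Cc U f -> exists2 M : R, 0 <= M & forall x, cabs (f x) <= M.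
Proof.
move=> [cf [K [KU cK f0]]].
have cfK : compact (f @` K).
  by apply: continuous_compact => //; exact: continuous_subspaceW cf.
have : compact (@cabs R @` (f @` K)).
  apply: continuous_compact => //; apply: continuous_subspaceT.
  exact: continuous_cabs.
move=> /compact_bounded[M [_ Mf]]; exists (`|M| + 1).
  by rewrite addr_ge0.
have M1 : M < `|M| + 1 by rewrite (le_lt_trans (ler_norm M))// ltrDl.
move=> x; have [Kx|nKx] := pselect (K x).
  apply: le_trans (ler_norm _) _; apply: (Mf _ M1).
  by exists (f x) => //; exists x.
by rewrite f0// cabs0 addr_ge0.
Qed.

End Cc.

Section CcG.
Context (R : realType) (G : topGroupoid).
Implicit Types (f g h : G -> R[i]) (U V : set G) (a b c : G).

Lemma Cc_star U g : open_bisection U -> Cc U g ->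
  Cc (gsetV U) (fun c => Num.conj (g (ginv c))).
Proof.
move=> bU gU; have oU := bisection_open bU.
have [_ [K [KU cK g0]]] := gU.
apply: (@Cc_intro _ _ _ (@ginv G @` K)).
- exact: (bisection_open (gsetV_bisection bU)).
- move=> c Uc; have := Cc_cvg oU gU Uc => cg.
  have cgi : (fun c => g (ginv c)) @ c --> g (ginv c).
    exact: (cvg_comp _ _ (@ginv_continuous G c) cg).
  apply/cvgrPdist_le => e e0; have /cvgrPdist_le/(_ e e0) := cgi.
  by apply: filterS => d; rewrite -rmorphB norm_conjC.
- by move=> _ [a Ka <-]; rewrite /gsetV /= ginvK; exact: KU.
- apply: continuous_compact => //; apply: continuous_subspaceT.
  exact: ginv_continuous.
- move=> c nKc; rewrite g0 ?rmorph0// => Kc; apply: nKc.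
  by exists (ginv c); rewrite // ginvK.
Qed.

Hypothesis hG : hausdorff_space (gunits G).

(** Although [G] may fail to be Hausdorff, its unit space is, so the composable pairs form a closed
    set; [gsetM K L] is then a continuous image of a compact set. *)
Lemma gsetM_compact K L : compact K -> compact L -> compact (@gsetM G K L).
Proof.
move=> cK cL.
have -> : @gsetM G K L = (fun p => gmul p.1 p.2) @`
    ((K `*` L) `&` [set p | gsrc p.1 = grng p.2]).
  apply/seteqP; split => c.
    by move=> [a [b [Ka Lb ab ->]]]; exists (a, b).
  by move=> [[a b] [[/= Ka Lb] ab] <-]; exists a, b.
apply: continuous_compact.
  by apply: continuous_subspaceW (@gmul_continuous G) => p [].
apply: compact_closedI; first exact: compact_setX.
apply: closed_equalizer => // p.
  apply: (@continuous_comp _ _ _ fst (@gsrc G)); first exact: cvg_fst.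
  exact: gsrc_continuous.
apply: (@continuous_comp _ _ _ snd (@grng G)); first exact: cvg_snd.
exact: grng_continuous.
Qed.

(** An arrow of [gsetM U V] factors uniquely through [U] and [V], so the convolution sum has a
    single term there and none elsewhere. *)
Lemma Cc_conv U V f g : open_bisection U -> open_bisection V -> Cc U f -> Cc V g ->
  exists h, [/\ Cc (gsetM U V) h,
    forall a b, U a -> V b -> gsrc a = grng b -> h (gmul a b) = f a * g b &
    forall c, ~ gsetM U V c -> h c = 0].
Proof.
move=> bU bV fU gV; have oU := bisection_open bU; have oV := bisection_open bV.
have oUV := bisection_open (gsetM_bisection bU bV).
have /open_bisectionP[_ [s sP] _] := bU; have [osU sK cs] := sP.
pose h c := if `[< gsetM U V c >] then
  f (s (grng c)) * g (gmul (ginv (s (grng c))) c) else 0.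
have hM a b : U a -> V b -> gsrc a = grng b -> h (gmul a b) = f a * g b.
  move=> Ua Vb ab; rewrite /h asboolT; last by exists a, b.
  by rewrite grngM// sK// gmulVKg.
have h0 c : ~ gsetM U V c -> h c = 0 by move=> nc; rewrite /h asboolF.
have [_ [K [KU cK f0]]] := fU; have [_ [L [LV cL g0]]] := gV.
exists h; split => //; apply: (@Cc_intro _ _ _ (gsetM K L)) => //.
- move=> c UVc; have [a [b [Ua Vb ab cE]]] := UVc; rewrite cE hM//.
  have cfa : (fun c => f (s (grng c))) @ gmul a b --> f a.
    apply: cvg_comp (Cc_cvg oU fU Ua).
    apply: cvg_comp (@grng_continuous G _) _.
    by rewrite grngM//; exact: cs.
  have cgb : (fun c => g (gmul (ginv (s (grng c))) c)) @ gmul a b --> g b.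
    exact: (cvg_comp _ _ (cvg_gsetM_factor sP Ua ab) (Cc_cvg oV gV Vb)).
  have : (fun c => f (s (grng c)) * g (gmul (ginv (s (grng c))) c)) @ gmul a b
      --> f a * g b by exact: (cvgM cfa cgb).
  apply: cvg_trans; apply: near_eq_cvg.
  have : \forall d \near gmul a b, gsetM U V d.
    by apply: open_nbhs_nbhs; split => //; rewrite -cE.
  by apply: filterS => d UVd; rewrite /h asboolT.
- move=> _ [a [b [Ka Lb ab ->]]].
  by exists a, b; split => //; [exact: KU|exact: LV].
- exact: gsetM_compact.
- move=> c nKL; have [[a [b [Ua Vb ab cE]]]|/h0//] := pselect (gsetM U V c).
  rewrite cE hM//; have [Ka|/f0->] := pselect (K a); last by rewrite mul0r.
  have [Lb|/g0->] := pselect (L b); last by rewrite mulr0.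
  by exfalso; apply: nKL; exists a, b.
Qed.

End CcG.

Section CG.
Context (R : realType) (G : topGroupoid).
Implicit Types (f g h : G -> R[i]) (U V : set G).

Lemma CG_ind (P : (G -> R[i]) -> Prop) : P (fun=> 0) ->
  (forall f g, P f -> P g -> P (fun a => f a + g a)) ->
  (forall c f, P f -> P (fun a => c * f a)) ->
  (forall U g, open_bisection U -> Cc U g -> P g) -> forall f, CG f -> P f.
Proof.
move=> P0 PD PZ PC _ [n [c [g [gU ->]]]].
elim: n c g gU => [|n IH] c g gU.
  by rewrite (_ : (fun _ => _) = fun=> 0)//; apply/funext => a; rewrite big_ord0.
rewrite (_ : (fun _ => _) = fun a =>
  \sum_(i < n) c (widen_ord (leqnSn n) i) * g (widen_ord (leqnSn n) i) a +
  c ord_max * g ord_max a); last by apply/funext => a; rewrite big_ord_recr.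
apply: PD; first by apply: (IH (fun i => c _) (fun i => g _)).
by apply: PZ; have [U bU gUm] := gU ord_max; exact: PC gUm.
Qed.

Lemma CG_0 : CG (fun=> 0 : R[i]) (G := G).
Proof.
exists 0%N, (fun=> 0), (fun=> fun=> 0); split; first by case.
by apply/funext => a; rewrite big_ord0.
Qed.

Lemma CG_Cc U g : open_bisection U -> Cc U g -> CG g.
Proof.
move=> bU gU; exists 1%N, (fun=> 1), (fun=> g); split; first by move=> _; exists U.
by apply/funext => a; rewrite big_ord1 mul1r.
Qed.

Lemma CG_Z c f : CG f -> CG (fun a => c * f a).
Proof.
move=> [n [k [g [gU ->]]]]; exists n, (fun i => c * k i), g; split => //.
by apply/funext => a; rewrite mulr_sumr; apply: eq_bigr => i _; rewrite mulrA.
Qed.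

Lemma CG_D f g : CG f -> CG g -> CG (fun a => f a + g a).
Proof.
move=> [n [k [p [pU ->]]]] [m [l [q [qU ->]]]].
exists (n + m)%N,
  (fun i => match fintype.split i with inl i => k i | inr j => l j end),
  (fun i => match fintype.split i with inl i => p i | inr j => q j end); split.
  by move=> i; case: fintype.split => j; [exact: pU|exact: qU].
apply/funext => a; rewrite big_split_ord; congr (_ + _); apply: eq_bigr => i _.
  by case: split_ordP => j /=; [move=> /lshift_inj ->|move/eqP; rewrite eq_lrshift].
by case: split_ordP => j /=; [move/eqP; rewrite eq_rlshift|move=> /rshift_inj ->].
Qed.

Lemma CG_star f : CG f -> CG (fun c => Num.conj (f (ginv c))).
Proof.
move: f; apply: CG_ind.
- rewrite (_ : (fun c => _) = fun=> 0); first exact: CG_0.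
  by apply/funext => a; rewrite rmorph0.
- move=> f g fG gG; rewrite (_ : (fun c => _) =
    fun c => Num.conj (f (ginv c)) + Num.conj (g (ginv c))); first exact: CG_D.
  by apply/funext => a; rewrite rmorphD.
- move=> c f fG; rewrite (_ : (fun c => _) =
    fun a => Num.conj c * Num.conj (f (ginv a))); first exact: CG_Z.
  by apply/funext => a; rewrite rmorphM.
- by move=> U g bU gU; apply: CG_Cc (Cc_star bU gU); exact: gsetV_bisection.
Qed.

End CG.

(** * Regular representations *)

Section regular_rep.
Context (R : realType) (G : topGroupoid).
Implicit Types (f g h : G -> R[i]) (U V : set G) (a b : opfam R G).

Definition in_fiber u (c : G) (cu : gsrc c == u) : fiber u := exist _ c cu.

Lemma fiberP (u : gunits G) (c : fiber u) : gsrc (val c) = u.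
Proof. exact/eqP/(valP c). Qed.

(** The only arrow whose product with [c] is [d] is [gmul d (ginv c)]. *)
Lemma regular_rep_coef f u (c d : fiber u) :
  \sum_(a \in [set: fiber (grng (val c))]) f (val a) * delta R (fiber_mul a) d =
  f (gmul (val d) (ginv (val c))).
Proof.
have dc : gsrc (val d) = gsrc (val c) by rewrite !fiberP.
have a0s : gsrc (gmul (val d) (ginv (val c))) == grng (val c).
  by rewrite gsrcM ?gsrcV ?grngV.
pose a0 : fiber (grng (val c)) := in_fiber a0s.
rewrite -(@fsbig_widen _ _ _ _ [set a0])//; first rewrite fsbig_set1.
  have -> : fiber_mul a0 = d by apply/val_inj; rewrite /= gmulgKV.
  by rewrite delta_coord eqxx mulr1.
move=> a [_ aa0]; rewrite /= /delta_fun.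
case: eqP => [da|_]; last by rewrite mulr0.
exfalso; apply: aa0; apply/val_inj => /=; rewrite da /= gmulgK//.
exact: fiberP.
Qed.

Lemma regular_repP f b : regular_rep f b <-> bounded_opfam b /\
  forall u (c d : fiber u), b u (delta R c) d = f (gmul (val d) (ginv (val c))).
Proof.
by split=> -[bb bf]; split => // u c d; rewrite bf regular_rep_coef.
Qed.

Lemma bounded_opfam_ext a b : bounded_opfam a -> bounded_opfam b ->
  (forall u (c d : fiber u), a u (delta R c) d = b u (delta R c) d) -> a = b.
Proof.
move=> /bounded_op_bound[M aM] /bounded_op_bound[N bN]; exact: op_bound_ext aM bN.
Qed.

Lemma regular_rep_uniq f a b : regular_rep f a -> regular_rep f b -> a = b.
Proof.
move=> /regular_repP[ab af] /regular_repP[bb bf].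
by apply: bounded_opfam_ext => // u c d; rewrite af bf.
Qed.

Lemma regular_repD f g a b : regular_rep f a -> regular_rep g b ->
  regular_rep (fun c => f c + g c) (opfamD a b).
Proof.
move=> /regular_repP[/bounded_op_bound[M aM] af].
move=> /regular_repP[/bounded_op_bound[N bN] bg].
apply/regular_repP; split; first exact: op_bound_bounded (op_boundD aM bN).
by move=> u c d; rewrite /opfamD ell2D_coord af bg.
Qed.

Lemma regular_repZ f (k : R[i]) a : regular_rep f a ->
  regular_rep (fun c => k * f c) (opfamZ k a).
Proof.
move=> /regular_repP[/bounded_op_bound[M aM] af].
apply/regular_repP; split; first exact: op_bound_bounded (op_boundZ k aM).
by move=> u c d; rewrite /opfamZ ell2Z_coord af.
Qed.

Lemma regular_rep_adjoint f a b : regular_rep f a ->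
  regular_rep (fun c => Num.conj (f (ginv c))) b -> opfam_adjoint a b.
Proof.
move=> /regular_repP[/bounded_op_bound[M aM] af].
move=> /regular_repP[/bounded_op_bound[N bN] bg].
apply: (op_bound_adjoint aM bN) => u i k; rewrite af bg conjCK; congr f.
by rewrite ginvM ?ginvK// grngV !fiberP.
Qed.

Lemma regular_rep0 : regular_rep (fun=> 0 : R[i]) (@opfam0 R G).
Proof.
apply/regular_repP; split; first exact: op_bound_bounded (op_bound0 R G).
by move=> u c d; rewrite /opfam0 ell20_coord.
Qed.

(* A function supported in a bisection acts as a weighted partial permutation of
   each fibre. *)
Lemma regular_rep_bisection U g (M : R) : open_bisection U ->
  (forall c, ~ U c -> g c = 0) -> 0 <= M -> (forall c, cabs (g c) <= M) ->
  exists2 b, regular_rep g b & op_bound b M.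
Proof.
move=> bU g0 M0 gM; have /open_bisectionP[_ [s [_ sK _]] _] := bU.
(* The operator sends [x] to the function with value [g e] times [x] at [gmul (ginv e) d], where [e]
   is the arrow of [U] with the range of [d]. [good d] says that [e] exists; its second clause is
   there because [s] is arbitrary off the image of [U]. *)
pose good (d : G) := U (s (grng d)) /\ grng (s (grng d)) = grng d.
have goodE e (d : G) : U e -> grng e = grng d -> good d /\ s (grng d) = e.
  by move=> Ue ed; rewrite /good -ed sK.
have ex_p u (d : fiber u) : exists d' : fiber u, good (val d) ->
    val d' = gmul (ginv (s (grng (val d)))) (val d).
  have [[Ud rd]|nd] := pselect (good (val d)); last by exists d.
  have e : gsrc (gmul (ginv (s (grng (val d)))) (val d)) == u.
    by rewrite gsrcM ?gsrcV// fiberP.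
  by exists (in_fiber e).
pose p u d := projT1 (cid (@ex_p u d)).
have pE u d : good (val d) -> val (@p u d) = gmul (ginv (s (grng (val d)))) (val d).
  by rewrite /p; case: cid.
pose w u (d : fiber u) : R[i] :=
  if `[< good (val d) >] then g (s (grng (val d))) else 0.
have w0 u (d : fiber u) : w u d != 0 -> good (val d).
  by rewrite /w; case: asboolP => //; rewrite eqxx.
have wM u (d : fiber u) : cabs (w u d) <= M.
  by rewrite /w; case: ifP => // _; rewrite cabs0.
have pinj u (i k : fiber u) : w u i != 0 -> w u k != 0 -> p u i = p u k -> i = k.
  move=> /w0 gi /w0 gk /(congr1 val); rewrite !pE//.
  case: gi gk => Ui ri [Uk rk] ik; apply/val_inj.
  have sik : s (grng (val i)) = s (grng (val k)).
    apply: (bisection_src_inj bU) => //.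
    have := congr1 (@grng G) ik.
    by rewrite !grngM ?gsrcV ?grngV.
  by rewrite -(gmulKVg ri) ik sik gmulKVg.
have ex u := weighted_perm_operator M0 (@wM u) (@pinj u).
pose b : opfam R G := fun u => projT1 (cid (ex u)).
have bM : op_bound b M.
  by split=> // u; rewrite /b; case: cid => T [].
exists b => //; apply/regular_repP; split; first exact: op_bound_bounded bM.
move=> u c d.
have -> : b u (delta R c) d = w u d * delta R c (p u d).
  by rewrite /b; case: (cid (ex u)) => T [_ _ TE] /=; rewrite TE.
have dc : gsrc (val d) = grng (ginv (val c)) by rewrite grngV !fiberP.
rewrite delta_coord; case: eqP => [pdc|pdc].
  rewrite mulr1 /w; case: asboolP => [gd|gd].
    congr g; have := pE u d gd; rewrite pdc.
    move: (s (grng (val d))) gd.2 => e re cE.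
    have ec : gsrc e = grng (val c) by rewrite cE grngM ?gsrcV// grngV.
    have -> : val d = gmul e (val c) by rewrite cE gmulKVg.
    by rewrite gmulgK.
  rewrite g0// => Udc; apply: gd.
  by have [] := goodE _ (val d) Udc (grngM dc).
rewrite mulr0; apply/esym/g0 => Udc; apply: pdc.
have [gd sd] := goodE _ (val d) Udc (grngM dc).
apply/val_inj; rewrite pE// sd ginvM// ginvK -gmulA ?grngV ?gsrcV ?fiberP//.
by rewrite gmulVg (_ : gsrc (val d) = gsrc (val c)) ?gmulg1// !fiberP.
Qed.

Lemma CG_regular_rep f : CG f -> exists b, regular_rep f b.
Proof.
move: f; apply: CG_ind.
- by exists (@opfam0 R G); exact: regular_rep0.
- by move=> f g [a fa] [b gb]; exists (opfamD a b); exact: regular_repD.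
- by move=> c f [a fa]; exists (opfamZ c a); exact: regular_repZ.
- move=> U g bU gU; have [M M0 gM] := Cc_bounded gU.
  have [b gb _] := regular_rep_bisection bU (fun c => Cc_out (x := c) gU) M0 gM.
  by exists b.
Qed.

(** Convolution is recorded through operators, so its bilinearity is inherited from composition and
    no sum over a range fibre has to be handled. *)
Definition convolves f g h := forall a b, regular_rep f a -> regular_rep g b ->
  regular_rep h (opfamM a b).

Hypothesis hG : hausdorff_space (gunits G).

Lemma Cc_convolves U V f g : open_bisection U -> open_bisection V -> Cc U f ->
  Cc V g -> exists2 h, CG h & convolves f g h.
Proof.
move=> bU bV fU gV; have [h [hUV hM h0]] := Cc_conv hG bU bV fU gV.
exists h; first exact: CG_Cc (gsetM_bisection bU bV) hUV.
move=> a b /regular_repP[/bounded_op_bound[M aM] af].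
move=> /regular_repP[/bounded_op_bound[N bN] bg].
apply/regular_repP; split; first exact: op_bound_bounded (op_boundM aM bN).
move=> u c d; rewrite /opfamM; have al : forall u, linear (a u) by case: aM.
have dc : gsrc (val d) = gsrc (val c) by rewrite !fiberP.
have dc' : gsrc (val d) = grng (ginv (val c)) by rewrite grngV.
have src_dc : gsrc (gmul (val d) (ginv (val c))) = grng (val c).
  by rewrite gsrcM// gsrcV.
(* At most one arrow [e] of [V] starts at the range of [c], so [b] sends the basis vector of [c] to
   [g e] times that of [gmul e c], or to 0 if there is none. *)
have [[e [Ve ec]]|nV] := pselect (exists e, V e /\ gsrc e = grng (val c)).
  have ecs : gsrc (gmul e (val c)) == u by rewrite gsrcM// fiberP.
  pose k : fiber u := in_fiber ecs.
  have -> : b u (delta R c) = g e *: delta R k.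
    apply/ell2P => d'; rewrite bg ell2Z_coord delta_coord.
    have d'c : gsrc (val d') = grng (ginv (val c)) by rewrite grngV !fiberP.
    case: eqP => [->|d'k]; first by rewrite mulr1 /= gmulgK.
    rewrite mulr0; apply: (Cc_out gV) => Vd'; apply: d'k; apply/val_inj => /=.
    have -> : e = gmul (val d') (ginv (val c)).
      by apply: (bisection_src_inj bV) => //; rewrite ec gsrcM// gsrcV.
    by rewrite gmulgKV// !fiberP.
  rewrite (opZ al) ell2Z_coord af /=.
  have [Ua|nUa] := pselect (U (gmul (val d) (ginv (gmul e (val c))))).
    rewrite mulrC -hM//; last first.
      by rewrite gsrcM ?gsrcV ?grngM// grngV gsrcM.
    congr h; rewrite ginvM// gmulA ?gsrcV ?grngV//.
    by rewrite gmulgKV// src_dc.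
  rewrite (Cc_out fU nUa) mulr0; apply/esym/h0 => -[x [y [Ux Vy xy dcE]]].
  apply: nUa; rewrite ginvM// gmulA ?gsrcV ?grngV// dcE.
  have -> : e = y.
    by apply: (bisection_src_inj bV) => //; rewrite ec -src_dc dcE gsrcM.
  by rewrite gmulgK.
have -> : b u (delta R c) = 0.
  apply/ell2P => d'; rewrite bg ell20_coord; apply: (Cc_out gV) => Vd'.
  have d'c : gsrc (val d') = grng (ginv (val c)) by rewrite grngV !fiberP.
  by apply: nV; exists (gmul (val d') (ginv (val c))); rewrite gsrcM// gsrcV.
rewrite (op0 al) ell20_coord; apply/esym/h0 => -[x [y [Ux Vy xy dcE]]].
by apply: nV; exists y; rewrite -src_dc dcE gsrcM.
Qed.

Lemma CG_convolves f g : CG f -> CG g -> exists2 h, CG h & convolves f g h.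
Proof.
(* The induction also carries a representative: the operator given for a sum or a multiple is
   rewritten, by uniqueness, in terms of representatives of the parts. *)
move=> + gG; suff [] : (exists b, regular_rep g b) /\
  forall f, CG f -> exists2 h, CG h & convolves f g h by move=> _; apply.
clear f; have CG0 := CG_0 R G; move: g gG; apply: CG_ind.
- split; first by exists (@opfam0 R G); exact: regular_rep0.
  move=> f fG; exists (fun=> 0) => // a b /regular_repP[[al _] _] b0.
  rewrite (regular_rep_uniq b0 regular_rep0) (_ : opfamM a _ = @opfam0 R G).
    exact: regular_rep0.
  apply: functional_extensionality_dep => u; apply/funext => x.
  by rewrite /opfamM /opfam0 (op0 al).
- move=> g1 g2 [[b1 gb1] H1] [[b2 gb2] H2]; split.
    by exists (opfamD b1 b2); exact: regular_repD.
  move=> f fG; have [h1 h1G c1] := H1 f fG; have [h2 h2G c2] := H2 f fG.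
  exists (fun x => h1 x + h2 x); first exact: CG_D.
  move=> a b fa gb; rewrite (regular_rep_uniq gb (regular_repD gb1 gb2)).
  rewrite (_ : opfamM a _ = opfamD (opfamM a b1) (opfamM a b2)).
    by apply: regular_repD; [exact: c1|exact: c2].
  apply: functional_extensionality_dep => u; apply/funext => x.
  by case: fa => -[al _] _; rewrite /opfamM /opfamD (opD al).
- move=> k g [[b0 gb0] H]; split.
    by exists (opfamZ k b0); exact: regular_repZ.
  move=> f fG; have [h hG' c] := H f fG.
  exists (fun x => k * h x); first exact: CG_Z.
  move=> a b fa gb; rewrite (regular_rep_uniq gb (regular_repZ k gb0)).
  rewrite (_ : opfamM a _ = opfamZ k (opfamM a b0)).
    by apply: regular_repZ; exact: c.
  apply: functional_extensionality_dep => u; apply/funext => x.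
  by case: fa => -[al _] _; rewrite /opfamM /opfamZ (opZ al).
- move=> V g bV gV; split; first by apply: CG_regular_rep; exact: CG_Cc gV.
  move=> f fG; suff [] : (exists a, regular_rep f a) /\
    exists2 h, CG h & convolves f g h by [].
  move: f fG; apply: CG_ind.
  + split; first by exists (@opfam0 R G); exact: regular_rep0.
    exists (fun=> 0) => // a b a0 _; rewrite (regular_rep_uniq a0 regular_rep0).
    exact: regular_rep0.
  + move=> f1 f2 [[a1 fa1] [h1 h1G c1]] [[a2 fa2] [h2 h2G c2]]; split.
      by exists (opfamD a1 a2); exact: regular_repD.
    exists (fun x => h1 x + h2 x); first exact: CG_D.
    move=> a b fa gb; rewrite (regular_rep_uniq fa (regular_repD fa1 fa2)).
    apply: (@regular_repD _ _ (opfamM a1 b) (opfamM a2 b)); first exact: c1.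
    exact: c2.
  + move=> k f [[a0 fa0] [h hG' c]]; split.
      by exists (opfamZ k a0); exact: regular_repZ.
    exists (fun x => k * h x); first exact: CG_Z.
    move=> a b fa gb; rewrite (regular_rep_uniq fa (regular_repZ k fa0)).
    by apply: (@regular_repZ _ _ (opfamM a0 b)); exact: c.
  + move=> U f bU fU; split; first by apply: CG_regular_rep; exact: CG_Cc fU.
    exact: Cc_convolves bU bV fU gV.
Qed.

Lemma Cr_concrete_cstar : concrete_cstar (@Cr R G).
Proof.
pose S : set (opfam R G) := [set b | exists2 f, @CG R G f & regular_rep f b].
have adj b : S b -> exists2 b', S b' & opfam_adjoint b b'.
  move=> [f fG fb]; have [b' fb'] := CG_regular_rep (CG_star fG).
  exists b'; last exact: regular_rep_adjoint fb fb'.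
  by exists (fun c => Num.conj (f (ginv c))); first exact: CG_star.
split.
- by move=> a [].
- move=> a b; apply: closureD => {}a {}b [f fG fa] [g gG gb].
  by exists (fun c => f c + g c); [exact: CG_D|exact: regular_repD].
- move=> k a; apply: closureZ => {}a [f fG fa].
  by exists (fun c => k * f c); [exact: CG_Z|exact: regular_repZ].
- move=> a b; apply: closureM => {}a {}b [f fG fa] [g gG gb].
  by have [h hG' fgh] := CG_convolves fG gG; exists h => //; exact: fgh.
- move=> a ab aC; exact: closure_limit.
- move=> a; apply: closure_adjoint => // b [f _ []//].
Qed.

Lemma regular_rep_Cr f b : CG f -> regular_rep f b -> Cr b.
Proof.
move=> fG fb; split; first by case: fb.
move=> e e0; exists b; first by exists f.
by move=> u x; rewrite subrr ell2_norm0 mulr_ge0 ?(ltW e0) ?ell2_norm_ge0.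
Qed.

Lemma jmapE a c :
  jmap a c = a (gsrc c) (delta R (fiber_unit (gsrc c))) (fiber_self c).
Proof. exact: dot_delta. Qed.

Lemma jmap_regular_rep f b c : regular_rep f b -> jmap b c = f c.
Proof.
by move=> /regular_repP[_ bf]; rewrite jmapE bf /= ginv_unit gmulg1.
Qed.

End regular_rep.

(** * Trivial isotropy *)

Section locally_compact_hausdorff.
Context (R : realType) (X : topologicalType).
Hypotheses (cX : has_compact_nbhs X) (hX : hausdorff_space X).
Implicit Types (x : X) (N : set X).

Lemma locally_compact_of_nbhs : locally_compact [set: X].
Proof.
move=> x _; have [K nK cK] := cX x; exists K; first by rewrite withinET.
by split => //; exact: compact_closed.
Qed.

(** Complete regularity gives [f] equal to 0 at [x] and to 1 off an open [W] contained in [N] and in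
    a compact [C]. As [1 - f] is only known to vanish off the open set [W], it is cut at level 1/2:
    the set where [f <= 1/2] is closed and lies in [W], so its intersection with [C] is a compact
    support. *)
Lemma bump_function x N : nbhs x N -> exists (h : X -> R) (K : set X),
  [/\ continuous h, compact K, K `<=` N, h x = 1 &
      (forall y, 0 <= h y <= 1) /\ forall y, ~ K y -> h y = 0].
Proof.
move=> nN; have [C nC cC] := cX x.
pose W := (N `&` C)°.
have Wx : W x by exact: filterI.
have clW : closed (~` W) by apply: open_closedC; exact: open_interior.
have nWx : ~ (~` W) x by [].
have := @locally_compact_completely_regular _ R locally_compact_of_nbhs hX.
move=> /(_ x _ clW nWx) /(@uniform_separatorP _ R)[f [cf f01 fx fW]].
have f01' y : 0 <= f y <= 1.
  by have := f01 (f y); rewrite /= in_itv /=; apply; exists y.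
pose h y := Num.max 0 (1 - 2 * f y).
exists h, (C `&` [set y | f y <= 2^-1]); split.
- move=> y; apply: (@continuous_max R X (fun=> 0) (fun y => 1 - 2 * f y) y).
    exact: cvg_cst.
  by apply: cvgB; [exact: cvg_cst|apply: cvgM; [exact: cvg_cst|exact: cf]].
- apply: compact_closedI => //.
  by apply: (@closed_comp _ _ f [set t | t <= 2^-1]) => // y _; exact: cf.
- move=> y [_ /= fy]; have [Wy|nWy] := pselect (W y).
    by have [] := interior_subset Wy.
  have fy1 : f y = 1 by apply: fW; exists y.
  by move: fy; rewrite fy1; lra.
- have fx0 : f x = 0 by apply: fx; exists x.
  by rewrite /h fx0 mulr0 subr0; apply/max_idPr.
- split => y.
    by rewrite /h le_max lexx /= ge_max ler01 /=; have /andP[] := f01' y; lra.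
  move=> nKy; apply/max_idPl; rewrite lerBlDr add0r.
  have [Wy|nWy] := pselect (W y).
    have [_ Cy] := interior_subset Wy.
    have : ~ (f y <= 2^-1) by move=> le; apply: nKy.
    by move=> /negP; rewrite -ltNge; lra.
  have -> : f y = 1 by apply: fW; exists y.
  by rewrite mulr1; lra.
Qed.

Lemma compact_nbhs_in x N : nbhs x N ->
  exists K, [/\ nbhs x K, compact K & K `<=` N].
Proof.
move=> /bump_function[h [K [ch cK KN hx [_ h0]]]]; exists K; split => //.
have : \forall y \near x, 0 < h y.
  by apply: (cvgr_gt (h x)); [exact: ch|rewrite hx].
apply: filterS => y hy; apply: contrapT => /h0 hy0.
by move: hy; rewrite hy0 ltxx.
Qed.

(** Compact sets with nonempty interior are nested through the [D n]. The filter that they generate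
    has a cluster point, which lies in every one of them because compact subsets of a Hausdorff
    space are closed. *)
Lemma baire_lch (D : nat -> set X) (V : set X) : (forall n, open (D n)) ->
  (forall n, dense (D n)) -> open V -> V !=set0 ->
  exists x, V x /\ forall n, D n x.
Proof.
move=> oD dD oV [x0 Vx0].
pose good (K : set X) := compact K /\ K° !=set0.
have step n (K : {K | good K}) : exists K' : {K | good K},
    projT1 K' `<=` projT1 K `&` D n.
  case: K => K [cK K0] /=.
  have [x [Kx Dx]] := dD n _ K0 (@open_interior _ K).
  have nKD : nbhs x (K `&` D n).
    by apply: filterI => //; exact: open_nbhs_nbhs.
  have [K' [nK' cK' K'K]] := compact_nbhs_in nKD.
  by have gK' : good K' by [split => //; exists x]; exists (exist _ _ gK').
have [K0 [nK0 cK0 K0V]] := compact_nbhs_in (open_nbhs_nbhs (conj oV Vx0)).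
have gK0 : good K0 by split => //; exists x0.
pose Ks := fix Ks n : {K | good K} := if n is m.+1 then projT1 (cid (step m (Ks m)))
  else exist _ _ gK0.
pose K n := projT1 (Ks n).
have KS n : K n.+1 `<=` K n `&` D n.
  by rewrite /K /=; case: cid.
have Kle n m : (n <= m)%N -> K m `<=` K n.
  elim: m => [|m IH]; first by rewrite leqn0 => /eqP ->.
  rewrite leq_eqVlt => /orP[/eqP->//|]; rewrite ltnS => /IH; apply: subset_trans.
  by move=> x /KS[].
pose F := filter_from [set: nat] K.
have PF : ProperFilter F.
  apply: filter_from_proper.
    apply: filter_from_filter; first by exists 0%N.
    move=> i j _ _; exists (maxn i j) => // x Kx.
    by split; apply: Kle Kx; rewrite ?leq_maxl ?leq_maxr.
  move=> i _; have [_ [x Kx]] := projT2 (Ks i).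
  by exists x; exact: interior_subset.
have FK n : F (K n) by exists n.
have [x [K0x Fx]] := cK0 F PF (FK 0%N).
have Kx n : K n x.
  have cKn : closed (K n) by apply: compact_closed => //; have [] := projT2 (Ks n).
  by apply: cKn => B nB; have [y [Ky By]] := Fx _ _ (FK n) nB; exists y.
exists x; split; first exact: K0V.
by move=> n; have [] := KS n _ (Kx n.+1).
Qed.

End locally_compact_hausdorff.

(** * Effectiveness and localization at units with trivial isotropy *)

Section etale_groupoid.
Context (R : realType) (G : topGroupoid).
Hypotheses (G_second_countable : @second_countable G)
  (G_locally_compact : has_compact_nbhs G) (G_etale : etale G)
  (hG : hausdorff_space (gunits G)) (G_effective : effective G).
Implicit Types (u v : gunits G) (U V : set G) (a b c : G).

Lemma open_units : open (range (@gunit G)).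
Proof. by rewrite -G_effective; exact: open_interior. Qed.

Lemma units_bisection : open_bisection (range (@gunit G)).
Proof.
have img (f : G -> gunits G) : (forall u, f (gunit u) = u) ->
    local_section f (range (@gunit G)) (@gunit G).
  move=> fu; split.
  - rewrite (_ : _ @` _ = setT); first exact: openT.
    by apply/seteqP; split => // u _; exists (gunit u) => //; exists u.
  - by move=> _ [u _ <-]; rewrite fu.
  - by move=> _ [u _ <-]; rewrite fu; exact: gunit_continuous.
apply/open_bisectionP; split; first exact: open_units.
- by exists (@gunit G); apply: img; exact: grng_unit.
- by exists (@gunit G); apply: img; exact: gsrc_unit.
Qed.

Lemma units_compact_nbhs : has_compact_nbhs (gunits G).
Proof.
move=> u; have [K nK cK] := G_locally_compact (gunit u).
exists (@gsrc G @` K); last first.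
  apply: continuous_compact => //; apply: continuous_subspaceT.
  exact: gsrc_continuous.
have : \forall v \near u, K (gunit v) by exact: gunit_continuous.
by apply: filterS => v Kv; exists (gunit v); rewrite ?gsrc_unit.
Qed.

Lemma bisection_nbhs c : exists2 U, open_bisection U & U c.
Proof.
have [B [_ bB] BU] := G_etale; have [U [BUU Uc] _] := bB c setT filterT.
by exists U => //; exact: BU.
Qed.

(** A basic open set inside a bisection is a bisection, so the bisections in a countable basis cover
    [G]. [f] numbers the basis; an index that gives no bisection is sent to the empty set. *)
Lemma countable_bisections : exists U : nat -> set G,
  (forall n, open_bisection (U n) \/ U n = set0) /\ forall c, exists n, U n c.
Proof.
have [B cB [Bo bB]] := G_second_countable; have [f f_inj] := countable_injP _ cB.
pose P n := [set U | [/\ B U, f U = n & open_bisection U]].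
exists (fun n => xget set0 (P n)); split.
  by move=> n; case: xgetP => [U _ [_ _ bU]|_]; [left|right].
move=> c; have [V bV Vc] := bisection_nbhs c.
have [W [BW Wc] WV] : filter_from [set U | B U /\ U c] id V.
  by apply: (bB c); apply: open_nbhs_nbhs; split => //; exact: bisection_open.
have bW : open_bisection W by apply: open_bisectionW WV => //; exact: Bo.
exists (f W); case: xgetP => [U _ [BU fUW _]|/(_ W)]; last by case.
by rewrite (f_inj U W (mem_set BU) (mem_set BW) fUW).
Qed.

Lemma bisection_src_open U : open_bisection U -> open (@gsrc G @` U).
Proof. by move=> /open_bisectionP[_ _ [s []]]. Qed.

Definition isotropy_in U : set (gunits G) :=
  @gsrc G @` (U `&` (@giso G `\` range (@gunit G))).

(** Let an open [W] lie in the closure. The nontrivial isotropy [E] is closed, so if some arrow of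
    [U] over [W] were outside [E], so would be those near it; their sources form an open subset of
    the closure that misses [isotropy_in U], as sources are injective on [U]. Hence the arrows of
    [U] over [W] form an open set inside [E], against effectiveness. *)
Lemma isotropy_nowhere_dense U : open_bisection U ->
  dense (~` closure (isotropy_in U)).
Proof.
move=> bU W [u Wu] oW; apply: contrapT => W0.
have WC : W `<=` closure (isotropy_in U).
  by move=> v Wv; apply: contrapT => nv; apply: W0; exists v.
pose E := @giso G `\` range (@gunit G).
have clE : closed E.
  apply: closedI; last by apply: open_closedC; exact: open_units.
  exact: (closed_equalizer hG (@grng_continuous G) (@gsrc_continuous G)).
pose O := U `&` (@gsrc G @^-1` W).
have oO : open O.
  apply: openI; first exact: bisection_open.
  by apply: open_comp => // c _; exact: gsrc_continuous.
have [v [[c [Uc Ec] cv] Wv]] : (isotropy_in U `&` W) !=set0.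
  exact: (WC u Wu W (open_nbhs_nbhs (conj oW Wu))).
have OE : O `<=` E.
  move=> d [Ud Wd]; apply: contrapT => nEd.
  pose P := O `&` ~` E.
  have oP : open P by apply: openI => //; exact: closed_openC.
  have bP : open_bisection P by apply: open_bisectionW bU oP _ => e [[]].
  have Pd : (@gsrc G @` P) (gsrc d) by exists d.
  have nP : nbhs (gsrc d) (@gsrc G @` P).
    by apply: open_nbhs_nbhs; split => //; exact: bisection_src_open.
  have [_ [[e [Ue Ee] <-] [e' [[Ue' _] nEe'] ee']]] := WC _ Wd _ nP.
  by apply: nEe'; rewrite (bisection_src_inj bU Ue' Ue ee').
have Oc : O c by split => //; rewrite /preimage /= cv.
have : (@giso G)° c.
  apply: (@interiorS _ O); first by move=> d /OE[].
  by rewrite /interior; exact: open_nbhs_nbhs.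
by rewrite G_effective; case: Ec.
Qed.

(* Effective second-countable groupoids are topologically principal. *)
Lemma trivial_isotropy_dense (V : set (gunits G)) : open V -> V !=set0 ->
  exists2 u, V u & forall c, grng c = u -> gsrc c = u -> c = gunit u.
Proof.
move=> oV V0; have [U [bU UT]] := countable_bisections.
have [|n|u [Vu Du]] := @baire_lch R _ units_compact_nbhs hG
  (fun n => ~` closure (isotropy_in (U n))) V _ _ oV V0.
- by move=> n; apply: closed_openC; exact: closed_closure.
- have [bUn|->] := bU n; first exact: isotropy_nowhere_dense.
  move=> W [w Ww] _; exists w; split => //.
  by rewrite (_ : isotropy_in set0 = set0) ?closure0// -subset0 => x [c [[]]].
exists u => // c rc sc; apply: contrapT => ncu.
have [n Unc] := UT c; apply: (Du n); apply: subset_closure.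
exists c => //; split => //; split; first by rewrite /giso /= rc sc.
by move=> [v _ vc]; apply: ncu; rewrite -sc -vc gsrc_unit.
Qed.

(** What survives of [f] after compression to [N] on both sides is a continuous function on the
    units. Continuity is a separate clause, since extension by 0 from a bisection may create
    discontinuities. *)
Definition localizes (f : G -> R[i]) (N : set (gunits G)) :=
  (forall c, N (grng c) -> N (gsrc c) -> f c != 0 -> c = gunit (gsrc c)) /\
  forall v, N v -> (fun v => f (gunit v)) @ v --> f (gunit v).

Lemma localizes_zero (f : G -> R[i]) (N : set (gunits G)) : open N ->
  (forall c, N (grng c) -> N (gsrc c) -> f c = 0) -> localizes f N.
Proof.
move=> oN f0; split => [c rc sc|v Nv]; first by rewrite f0// eqxx.
have -> : f (gunit v) = 0 by apply: f0; rewrite ?grng_unit ?gsrc_unit.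
apply: cvg_near_cst; have : nbhs v N by exact: open_nbhs_nbhs.
by apply: filterS => w Nw; apply: f0; rewrite ?grng_unit ?gsrc_unit.
Qed.

(** Consider the arrow [c] of [U] with source [u]. If there is none, the support of [g] has a closed
    set of sources, which misses [u]. If [c] ends at [u], it is a unit, and over the units contained
    in [U] there is no other arrow of [U]. Otherwise disjoint neighbourhoods of [grng c] and [u]
    keep the arrows of [U] that start near [u] from ending near [u]. *)
Lemma Cc_localizes U g u : (forall c, grng c = u -> gsrc c = u -> c = gunit u) ->
  open_bisection U -> Cc U g -> exists2 N, open_nbhs u N & localizes g N.
Proof.
move=> triv bU gU; have oU := bisection_open bU.
have [[c [Uc cu]]|nU] := pselect (exists c, U c /\ gsrc c = u); last first.
  have [_ [K [KU cK g0]]] := gU.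
  have clK : closed (@gsrc G @` K).
    apply: compact_closed => //; apply: continuous_compact => //.
    by apply: continuous_subspaceT; exact: gsrc_continuous.
  exists (~` (@gsrc G @` K)).
    split; first exact: closed_openC.
    by move=> [c Kc cu]; apply: nU; exists c; split => //; exact: KU.
  apply: localizes_zero; first exact: closed_openC.
  by move=> c _ nc; apply: g0 => Kc; apply: nc; exists c.
have [ru|ru] := pselect (grng c = u).
  have cE := triv c ru cu.
  exists (@gunit G @^-1` U).
    split; last by rewrite /preimage /= -cE.
    by apply: open_comp => // v _; exact: gunit_continuous.
  split => [d _ Ud gd|v Uv].
    have Ud' : U d by apply: contrapT => /(Cc_out gU) d0; rewrite d0 eqxx in gd.
    by apply: (bisection_src_inj bU) => //; rewrite gsrc_unit.
  exact: (cvg_comp _ _ (@gunit_continuous G v) (Cc_cvg oU gU Uv)).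
have := hG; rewrite open_hausdorff => /(_ (grng c) u) [|[P Q]/=].
  exact/eqP.
move=> [/set_mem Pc /set_mem Qu] [oP oQ /eqP PQ].
have /open_bisectionP[_ _ [s [osU sK cs]]] := bU.
pose V := U `&` (@grng G @^-1` P).
have oV : open V.
  by apply: openI => //; apply: open_comp => // d _; exact: grng_continuous.
have bV : open_bisection V by apply: open_bisectionW bU oV _ => d [].
exists (Q `&` (@gsrc G @` V)).
  split; first by apply: openI => //; exact: bisection_src_open.
  by split => //; exists c.
apply: localizes_zero; first by apply: openI => //; exact: bisection_src_open.
move=> d [Qd _] [_ [e [Ue Pe] ed]]; apply: (Cc_out gU) => Ud.
have de := bisection_src_inj bU Ue Ud ed.
have : set0 (grng d) by rewrite -PQ; split => //; rewrite -de.
by [].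
Qed.

Lemma CG_localizes f u : (forall c, grng c = u -> gsrc c = u -> c = gunit u) ->
  CG f -> exists2 N, open_nbhs u N & localizes f N.
Proof.
move=> triv; move: f; apply: CG_ind.
- exists setT; first by split => //; exact: openT.
  by apply: localizes_zero => //; exact: openT.
- move=> f g [N [oN Nu] [fN cf]] [M [oM Mu] [gM cg]].
  exists (N `&` M); first by split => //; exact: openI.
  split => [c [Nr Mr] [Ns Ms] fg|v [Nv Mv]].
    have [f0|f0] := eqVneq (f c) 0; last exact: fN.
    by apply: gM => //; rewrite f0 add0r in fg.
  exact: (cvgD (cf v Nv) (cg v Mv)).
- move=> k f [N oN [fN cf]]; exists N; first exact: oN.
  split => [c Nr Ns|v Nv].
    by rewrite mulf_eq0 negb_or => /andP[_]; exact: fN.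
  exact: (cvgM (@cvg_cst _ k _ _ _) (cf v Nv)).
- move=> U g bU gU; exact: Cc_localizes bU gU.
Qed.

Lemma extend_by_0_unit (h : gunits G -> R[i]) u : extend_by_0 h (gunit u) = h u.
Proof. by rewrite /extend_by_0 gsrc_unit eqxx. Qed.

Lemma extend_by_0_out (h : gunits G -> R[i]) c : ~ range (@gunit G) c ->
  extend_by_0 h c = 0.
Proof.
move=> nc; rewrite /extend_by_0; case: eqP => // cE.
by exfalso; apply: nc; rewrite cE.
Qed.

Lemma Cc_extend_by_0 (h : gunits G -> R[i]) : Cc setT h ->
  Cc (range (@gunit G)) (extend_by_0 h).
Proof.
move=> hC; have [_ [K [_ cK h0]]] := hC.
apply: (@Cc_intro _ _ _ (@gunit G @` K)); first exact: open_units.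
- move=> c uc; have nc : nbhs c (range (@gunit G)).
    by apply: open_nbhs_nbhs; split => //; exact: open_units.
  have : (fun d => h (gsrc d)) @ c --> extend_by_0 h c.
    have -> : extend_by_0 h c = h (gsrc c).
      by case: uc => u _ <-; rewrite extend_by_0_unit gsrc_unit.
    exact: (cvg_comp _ _ (@gsrc_continuous G c) (Cc_cvg openT hC I)).
  apply: cvg_trans; apply: near_eq_cvg.
  by apply: filterS nc => _ [u _ <-]; rewrite extend_by_0_unit gsrc_unit.
- by move=> _ [u _ <-]; exists u.
- apply: continuous_compact => //; apply: continuous_subspaceT.
  exact: gunit_continuous.
- move=> c nKc; rewrite /extend_by_0; case: eqP => // cE; apply: h0 => Ks.
  by apply: nKc; exists (gsrc c).
Qed.

End etale_groupoid.

(** * Injectivity *)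

Section units.
Context (R : realType) (G : topGroupoid).
Implicit Types (h : gunits G -> R[i]) (a b : opfam R G).

Lemma delta_norm_le1 (X : choiceType) (i : X) : ell2_norm (delta R i) <= 1.
Proof.
apply: ell2_norm_le => // s us; rewrite expr1n.
have [si|si] := boolP (i \in s).
  rewrite (bigD1_seq i)//= big1 ?addr0; last first.
    by move=> k ki; rewrite /delta_fun (negbTE ki) normsq0.
  by rewrite /delta_fun eqxx /normsq /= expr1n expr0n addr0.
rewrite big_seq big1 ?ler01// => k ks; rewrite delta_coord.
by case: eqP => [ki|_]; [rewrite -ki ks in si|rewrite normsq0].
Qed.

(** [jmap] lives over [gsrc (val c)], which equals [u] only propositionally; eliminating that
    equality avoids a transport between fibres. *)
Lemma jmap_fiber a u (c : fiber u) :
  jmap a (val c) = a u (delta R (fiber_unit u)) c.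
Proof.
case: c => c cu; have e := eqP cu; rewrite jmapE /=; move: cu.
by case: u / e => cu; congr (a _ _ _); apply/val_inj.
Qed.

Lemma jmap_dist a b (e : R) c : 0 <= e -> opfam_dist_le a b e ->
  cabs (jmap a c - jmap b c) <= e.
Proof.
move=> e0 ab; rewrite !jmapE -ell2B_coord.
apply: le_trans (coord_le _ _) (le_trans (ab _ _) _).
by rewrite ler_piMr// delta_norm_le1.
Qed.

Lemma regular_rep_unit h b u (x : ell2 R (fiber u)) d :
  regular_rep (extend_by_0 h) b -> b u x d = h (grng (val d)) * x d.
Proof.
move=> /regular_repP[/bounded_op_bound[M [bl M0 bM]] bh].
apply/eqP; rewrite -subr_eq0; apply/eqP.
apply: (@functional_ext R _ (fun x => b u x d - h (grng (val d)) * x d)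
  (M + cabs (h (grng (val d))))).
- by rewrite addr_ge0 ?cabs_ge0.
- by move=> y z; rewrite (opD bl) !ell2D_coord; ring.
- by move=> k y; rewrite (opZ bl) !ell2Z_coord; ring.
- move=> y; apply: le_trans (cabsD _ _) _; rewrite cabsN cabsM mulrDl lerD//.
    exact: le_trans (coord_le _ _) (bM _ _).
  by rewrite ler_wpM2l ?cabs_ge0 ?coord_le.
- move=> c; rewrite bh delta_coord; case: eqP => [->|dc].
    by rewrite gmulgV extend_by_0_unit mulr1 subrr.
  rewrite mulr0 subr0; apply: extend_by_0_out => -[v _ vE]; apply: dc.
  have dcs : gsrc (val d) = grng (ginv (val c)) by rewrite grngV !fiberP.
  apply/val_inj; rewrite -[LHS](@gmulgKV _ _ (val c)) ?fiberP//.
  have vc : v = grng (val c).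
    by rewrite -(gsrc_unit v) vE gsrcM// gsrcV.
  by rewrite -vE vc gmul1g.
Qed.

End units.

Section star_homomorphism.
Context (R : realType) (G : topGroupoid).
Hypotheses (G_locally_compact : has_compact_nbhs G)
  (hG : hausdorff_space (gunits G)) (G_effective : effective G).
Context (B : cstarAlgType R) (rho : opfam R G -> B).
Hypotheses (rho_hom : Cr_star_hom rho) (rho_inj : set_inj (@C0units R G) rho).
Implicit Types (h : gunits G -> R[i]) (a b : opfam R G) (u v : gunits G).

Let cC := Cr_concrete_cstar R hG.

Lemma Cr_star_hom_on : star_hom_on (@Cr R G) rho.
Proof.
case: rho_hom => hD hZ hM hadj; split.
- by move=> a b aC bC; apply: hD; exact: mem_set.
- by move=> k a aC; apply: hZ; exact: mem_set.
- by move=> a b aC bC; apply: hM; exact: mem_set.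
- by move=> a b aC bC; apply: hadj; exact: mem_set.
Qed.

Let hrho := Cr_star_hom_on.

Lemma unit_operator h (M : R) :
  Cc setT h -> 0 <= M -> (forall v, cabs (h v) <= M) ->
  exists b, [/\ regular_rep (extend_by_0 h) b, op_bound b M & Cr b].
Proof.
move=> hC M0 hM; have eC := Cc_extend_by_0 G_effective hC.
have bu := units_bisection G_effective.
have [|c|b hb bM] := @regular_rep_bisection R G _ (extend_by_0 h) M bu _ M0.
- by move=> c; exact: extend_by_0_out.
- by rewrite /extend_by_0; case: ifP => // _; rewrite cabs0.
- by exists b; split => //; apply: regular_rep_Cr hb; exact: CG_Cc eC.
Qed.

Lemma unit_operator_C0units h b : Cc setT h -> regular_rep (extend_by_0 h) b ->
  C0units b.
Proof.
move=> hC hb; have [ch [K [_ cK h0]]] := hC.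
exists h.
  split; first by move=> v; exact: (Cc_cvg openT hC I).
  by move=> e e0; exists K => // v /h0 ->; rewrite normr0.
split; first by case: hb.
move=> e e0; exists h, b; split => //.
  by move=> v; rewrite subrr normr0 lecR ltW.
by move=> u x; rewrite subrr ell2_norm0 mulr_ge0 ?(ltW e0) ?ell2_norm_ge0.
Qed.

Lemma C0units0 : C0units (@opfam0 R G).
Proof.
apply: (@unit_operator_C0units (fun=> 0)).
  apply: (@Cc_intro _ _ _ set0) => //; first exact: openT.
    by move=> v _; exact: cvg_cst.
  exact: compact0.
have := regular_rep0 R G; congr regular_rep.
by apply/funext => c; rewrite /extend_by_0; case: ifP.
Qed.

Lemma rho0 : rho (@opfam0 R G) = 0.
Proof.
have C0 : Cr (@opfam0 R G).
  exact: (regular_rep_Cr (CG_0 R G) (regular_rep0 R G)).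
have := shZ hrho 0 C0; rewrite scale0r => <-; congr rho.
apply: functional_extensionality_dep => u; apply/funext => x.
by rewrite /opfamZ scale0r.
Qed.

Lemma continuous_real_complex (X : topologicalType) (f : X -> R) x :
  {for x, continuous f} -> (fun y => (f y)%:C%C) @ x --> (f x)%:C%C.
Proof.
move=> cf; apply/cvgrPdist_le => _ /gt0_complex[e e0 ->].
have /cvgrPdist_le/(_ e e0) := cf.
by apply: filterS => y; rewrite -rmorphB cabsE cabs_real lecR.
Qed.

(* Compressing an approximant [f] of [b] by functions [p], [w] supported near [u]
   leaves the function [w ^ 2] on the units, so [rho] sends [w ^ 2] to an element
   of norm at most 1/2; it therefore kills any [m] with [m * w = m]. *)
Lemma jmap_unit_eq0 b u : (forall c, grng c = u -> gsrc c = u -> c = gunit u) ->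
  Cr b -> rho b = 0 -> jmap b (gunit u) = 0.
Proof.
move=> triv bC rb; apply: contrapT => jb0.
pose t := cabs (jmap b (gunit u)).
have t0 : 0 < t.
  by rewrite lt_neqAle cabs_ge0 andbT eq_sym; apply/eqP => /cabs0_eq.
(* [p] will be bounded by 4 / t and [w] by 1, and [star_hom_bound] costs a factor 2 for each of
   three operators: 8 * (4 / t) * (t / 64) = 1/2. *)
have e0 : 0 < t / 64 by rewrite divr_gt0.
have [_ /(_ _ e0)[b' [f fG fb'] bb']] := bC.
have b'C : Cr b' by exact: regular_rep_Cr fb'.
have [N [oN Nu] [fN cf]] := CG_localizes hG triv fG.
pose F v := f (gunit v).
have Fu : t / 2 < cabs (F u).
  have := jmap_dist (gunit u) (ltW e0) bb'.
  rewrite (jmap_regular_rep _ fb') -/(F u).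
  have := cabsD (jmap b (gunit u) - F u) (F u); rewrite subrK -/t; lra.
pose N' := (N `&` [set v | t / 4 < cabs (F v)])°.
have N'u : nbhs u N'.
  apply: open_nbhs_nbhs; split; first exact: open_interior.
  apply: filterI; first exact: open_nbhs_nbhs.
  have cF : (fun v => cabs (F v)) @ u --> cabs (F u).
    exact: (cvg_comp _ _ (cf u Nu) (@continuous_cabs R (F u))).
  by apply: (cvgr_gt _ cF); lra.
have N'N v : N' v -> N v by move=> /interior_subset[].
have N'F v : N' v -> t / 4 < cabs (F v) by move=> /interior_subset[].
have [h [K [ch cK KN' hu [h01 h0]]]] :=
  bump_function R (units_compact_nbhs G_locally_compact) hG N'u.
(* Two cut-offs of one bump: [w] is 1 wherever [m] is nonzero, namely where [h > 1/2], both vanish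
   off [K], and [m u = 1]. *)
pose w v : R[i] := (Num.min 1 (2 * h v))%:C%C.
pose m v : R[i] := (Num.max 0 (2 * h v - 1))%:C%C.
(* Chosen so that [p * F * w = w * w]; the lower bound t / 4 for |F| on [N'] bounds [p]. *)
pose p v : R[i] := w v / F v.
have c2h : continuous (fun v => 2 * h v).
  by move=> v; apply: cvgM; [exact: cvg_cst|exact: ch].
have w0 v : ~ K v -> w v = 0.
  by move=> /h0 hv; rewrite /w hv mulr0 min_r ?ler01.
have cw v : w @ v --> w v.
  apply: continuous_real_complex.
  apply: (@continuous_min R _ (fun=> 1) (fun v => 2 * h v)); last exact: c2h.
  exact: cvg_cst.
have wC : Cc setT w.
  by apply: (@Cc_intro _ _ _ K) => //; exact: openT.
have mC : Cc setT m.
  apply: (@Cc_intro _ _ _ K) => //; first exact: openT.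
    move=> v _; apply: continuous_real_complex.
    apply: (@continuous_max R _ (fun=> 0) (fun v => 2 * h v - 1)).
      exact: cvg_cst.
    by apply: cvgB; [exact: c2h|exact: cvg_cst].
  by move=> v /h0 hv; rewrite /m hv mulr0 max_l//; lra.
have Fn0 v : N' v -> F v != 0.
  by move=> /N'F; apply: contraTneq => ->; rewrite cabs0 -leNgt; lra.
have pC : Cc setT p.
  apply: (@Cc_intro _ _ _ K) => //; first exact: openT.
    move=> v _; have [N'v|nN'v] := pselect (N' v).
      by apply: (cvgM (cw v)); apply: cvgV; [exact: Fn0|exact/cf/N'N].
    (* [F] is known to be continuous only inside [N]; off [N'], [p] is locally zero because [K] is
       closed. *)
    have nKv : ~ K v by move=> /KN'.
    have nv : nbhs v (~` K).
      apply: open_nbhs_nbhs; split => //; apply: closed_openC.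
      exact: compact_closed.
    rewrite /p w0// mul0r; apply: cvg_near_cst.
    by apply: filterS nv => x /w0; rewrite /p => ->; rewrite mul0r.
  by move=> v /w0; rewrite /p => ->; rewrite mul0r.
have wwC : Cc setT (fun v => w v * w v).
  apply: (@Cc_intro _ _ _ K) => //; first exact: openT.
    by move=> v _; exact: (cvgM (cw v) (cw v)).
  by move=> v /w0 ->; rewrite mul0r.
have w1 v : cabs (w v) <= 1.
  rewrite cabs_real ger0_norm ?ge_min ?lexx// le_min ler01 mulr_ge0//.
  by have /andP[] := h01 v.
have p1 v : cabs (p v) <= 4 / t.
  have [Kv|/w0 pv] := pselect (K v); last first.
    by rewrite /p pv mul0r cabs0 divr_ge0// ltW.
  have Fv := N'F _ (KN' _ Kv).
  have Fv0 : 0 < cabs (F v) by apply: lt_trans Fv; rewrite divr_gt0.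
  rewrite /p cabsM cabsV ler_pdivrMr//; apply: le_trans (w1 v) _.
  by rewrite mulrAC ler_pdivlMr// mul1r; lra.
have [M M0 mM] := Cc_bounded mC.
have [M' M'0 wwM] := Cc_bounded wwC.
have t4 : 0 <= 4 / t by rewrite divr_ge0// ltW.
have [Lw [wL Lwb LwC]] := unit_operator wC ler01 w1.
have [Lp [pL Lpb LpC]] := unit_operator pC t4 p1.
have [Lm [mL Lmb LmC]] := unit_operator mC M0 mM.
have [Lww [wwL Lwwb LwwC]] := unit_operator wwC M'0 wwM.
have b'l : forall u, linear (b' u) by case: fb' => -[].
have LwLw : opfamM Lp (opfamM b' Lw) = Lww.
  apply: bounded_opfam_ext.
  - exact: (ccb cC (ccM cC LpC (ccM cC b'C LwC))).
  - exact: (ccb cC LwwC).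
  move=> z c d; rewrite /opfamM (regular_rep_unit _ _ pL).
  have -> : Lw z (delta R c) = w (grng (val c)) *: delta R c.
    apply/ell2P => k; rewrite (regular_rep_unit _ _ wL) ell2Z_coord delta_coord.
    by case: eqP => [->//|_]; rewrite !mulr0.
  have /regular_repP[_ ->] := wwL.
  rewrite (opZ b'l) ell2Z_coord; have /regular_repP[_ ->] := fb'.
  have dc : gsrc (val d) = grng (ginv (val c)) by rewrite grngV !fiberP.
  have -> : grng (val d) = grng (gmul (val d) (ginv (val c))) by rewrite grngM.
  have -> : grng (val c) = gsrc (gmul (val d) (ginv (val c))).
    by rewrite gsrcM// gsrcV.
  (* Both coefficients depend only on [g], the product of [d] with [ginv c]; the left one is
     [p (grng g) * f g * w (gsrc g)], and [localizes] makes it vanish unless [g] is a unit. *)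
  move: (gmul _ _) => g {c d dc z}.
  have [[v _ <-]|ng] := pselect (range (@gunit G) g).
    rewrite extend_by_0_unit grng_unit gsrc_unit -/(F v) /p.
    have [N'v|nN'v] := pselect (N' v); last first.
      by rewrite w0 ?mul0r// => /KN'.
    by have := Fn0 v N'v; move: (F v) => z z0; field.
  rewrite extend_by_0_out//.
  have [Kr|/w0 pr] := pselect (K (grng g)); last by rewrite /p pr !mul0r.
  have [Ks|/w0->] := pselect (K (gsrc g)); last by rewrite mul0r mulr0.
  have [->|fg] := eqVneq (f g) 0; first by rewrite !mulr0.
  have gE : g = gunit (gsrc g) by apply: fN => //; exact/N'N/KN'.
  by exfalso; apply: ng; exists (gsrc g).
have LmLww : opfamM Lm Lww = Lm.
  apply: functional_extensionality_dep => z; apply/funext => x; apply/ell2P => d.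
  rewrite /opfamM !(regular_rep_unit _ _ mL) (regular_rep_unit _ _ wwL).
  rewrite mulrA; congr (_ * _); rewrite /m /w.
  have [hv|hv] := leP (2 * h (grng (val d))) 1.
    by rewrite max_l ?mul0r//; lra.
  by rewrite rmorph1 !mulr1.
pose x := opfamD b' (opfamZ (-1) b).
have nbC := ccZ cC (-1) bC.
have xC : Cr x := ccD cC b'C nbC.
have rx : rho x = rho b'.
  by rewrite (shD hrho b'C nbC) (shZ hrho _ bC) rb scaler0 addr0.
have xe : opfam_norm_le x (t / 64).
  by move=> z y; rewrite /x /opfamD /opfamZ scaleN1r; exact: dist_sym.
have rww : rho Lww = cmul (rho Lp) (cmul (rho x) (rho Lw)).
  by rewrite -LwLw (shM hrho LpC (ccM cC b'C LwC)) (shM hrho b'C LwC) rx.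
have [_ _ Lwn] := Lwb; have [_ _ Lpn] := Lpb.
have t4' : 0 < 4 / t by rewrite divr_gt0.
have rwwn : `|rho Lww| <= (2^-1)%:C%C.
  rewrite rww; apply: le_trans (cnormM _ _) _.
  apply: (@le_trans _ _
    ((2 * (4 / t))%:C%C * ((2 * (t / 64))%:C%C * (2 * 1)%:C%C))).
    apply: ler_pM => //; first exact: (star_hom_bound cC hrho t4' LpC Lpn).
    apply: le_trans (cnormM _ _) _; apply: ler_pM => //.
      exact: (star_hom_bound cC hrho e0 xC xe).
    exact: (star_hom_bound cC hrho ltr01 LwC Lwn).
  rewrite -!rmorphM lecR.
  have -> : 2 * (4 / t) * (2 * (t / 64) * (2 * 1)) = 2^-1 by field; rewrite gt_eqF.
  exact: lexx.
have rm : rho Lm = 0.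
  apply/eqP; rewrite -normr_eq0; apply/eqP.
  have : `|rho Lm| <= `|rho Lm| * (2^-1)%:C%C.
    rewrite -{1}LmLww (shM hrho LmC LwwC); apply: le_trans (cnormM _ _) _.
    by rewrite ler_wpM2l.
  rewrite fmorphV rmorph_nat ler_pdivlMr// mulr_natr mulr2n -subr_le0 addrK.
  by move=> n0; apply/eqP; rewrite eq_le n0 normr_ge0.
have Lm0 : Lm = @opfam0 R G.
  apply: rho_inj.
  - exact/mem_set/(unit_operator_C0units mC mL).
  - exact/mem_set/C0units0.
  - by rewrite rm rho0.
have : jmap Lm (gunit u) = m u by rewrite (jmap_regular_rep _ mL) extend_by_0_unit.
rewrite Lm0 jmapE /opfam0 ell20_coord /m hu mulr1 => /esym.
have -> : Num.max 0 (2 - 1) = 1 :> R by rewrite max_r; lra.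
by move/eqP; rewrite rmorph1 oner_eq0.
Qed.

(** The bump is built on the unit space and pulled back to [V] along the range map; the local
    section carries its compact support into [V]. *)
Lemma bisection_bump V c : open_bisection V -> V c ->
  exists2 g : G -> R[i], Cc V g & g c = 1.
Proof.
move=> bV Vc; have oV := bisection_open bV.
have /open_bisectionP[_ [s [osV sK cs]] _] := bV.
have nV : nbhs (grng c) (@grng G @` V).
  by apply: open_nbhs_nbhs; split => //; exists c.
have [h [K [ch cK KV hc [_ h0]]]] :=
  bump_function R (units_compact_nbhs G_locally_compact) hG nV.
pose g d : R[i] := if `[< V d >] then (h (grng d))%:C%C else 0.
exists g; last by rewrite /g asboolT// hc rmorph1.
apply: (@Cc_intro _ _ _ (s @` K)) => //.
- move=> d Vd; have nd : nbhs d V by exact: open_nbhs_nbhs.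
  have : (fun e => (h (grng e))%:C%C) @ d --> g d.
    rewrite /g asboolT//.
    have chd := continuous_real_complex (ch (grng d)).
    exact: (cvg_comp _ _ (@grng_continuous G d) chd).
  apply: cvg_trans; apply: near_eq_cvg.
  by apply: filterS nd => e Ve; rewrite /g asboolT.
- by move=> _ [v /KV[d Vd <-] <-]; rewrite sK.
- apply: continuous_compact => //; apply: continuous_subspaceW KV _.
  rewrite continuous_open_subspace// => v /set_mem[d Vd <-].
  by rewrite /continuous_at sK//; exact: cs.
- move=> d nKd; rewrite /g; case: asboolP => // Vd; rewrite h0// => Kd.
  by apply: nKd; exists (grng d) => //; rewrite sK.
Qed.

(** The vector to which [b] is applied need not be finitely supported, so [b] is moved to the other
    side of the inner product. Its adjoint sends the basis vector of the unit to that of [c],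
    because [ginv c] is the only arrow of [V] with range [gsrc c]. *)
Lemma jmap_translate V (g : G -> R[i]) b a c : open_bisection V -> Cc V g ->
  V (ginv c) -> g (ginv c) = 1 -> regular_rep g b ->
  jmap (opfamM b a) (gunit (gsrc c)) = jmap a c.
Proof.
move=> bV gV Vc gc gb.
have [b' gb'] := CG_regular_rep (CG_star (CG_Cc bV gV)).
have bb' := regular_rep_adjoint gb gb'.
rewrite (jmap_fiber _ (fiber_unit (gsrc c))) (jmap_fiber _ (fiber_self c)) /opfamM.
rewrite -dot_delta bb' (_ : b' _ _ = delta R (fiber_self c)) ?dot_delta//.
apply/ell2P => d; have /regular_repP[_ ->] := gb'.
rewrite delta_coord /= ginv_unit.
have -> : gunit (gsrc c) = gunit (gsrc (val d)) by rewrite fiberP.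
rewrite gmulg1; case: eqP => [->|dc]; first by rewrite /= gc rmorph1.
rewrite (Cc_out gV) ?rmorph0// => Vd; apply: dc; apply/val_inj => /=.
apply/(inv_inj (@ginvK G)); apply: (bisection_rng_inj bV) => //.
by rewrite !grngV fiberP.
Qed.

End star_homomorphism.

Theorem theorem4p4 (R : realType) (G : topGroupoid)
  (G_second_countable : @second_countable G)
  (G_locally_compact : has_compact_nbhs G)
  (G_etale : etale G)
  (G_units_hausdorff : hausdorff_space (gunits G))
  (G_effective : effective G)
  (G_supp : forall a : opfam R G, Cr a -> a <> @opfam0 R G ->
    (supp (jmap a))° !=set0)
  (B : cstarAlgType R) (rho : opfam R G -> B)
  (rho_hom : Cr_star_hom rho)
  (rho_inj : set_inj (@C0units R G) rho) :
  set_inj (@Cr R G) rho.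
Proof.
have cC := Cr_concrete_cstar R G_units_hausdorff.
have hrho := Cr_star_hom_on rho_hom.
move=> a a' /set_mem aC /set_mem a'C raa'.
pose x := opfamD a (opfamZ (-1) a').
have na'C := ccZ cC (-1) a'C.
have xC : Cr x := ccD cC aC na'C.
have rx : rho x = 0.
  by rewrite (shD hrho aC na'C) (shZ hrho _ a'C) raa' scaleN1r subrr.
suff x0 : x = @opfam0 R G.
  apply: functional_extensionality_dep => u; apply/funext => v.
  have := congr1 (fun b : opfam R G => b u v) x0.
  by rewrite /x /opfamD /opfamZ /opfam0 scaleN1r => /eqP; rewrite subr_eq0 => /eqP.
apply: contrapT => /(G_supp _ xC)[c0 c0S].
have [U bU Uc0] := bisection_nbhs G_etale c0.
pose O := U `&` (supp (jmap x))°.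
have oO : open O.
  by apply: openI; [exact: bisection_open|exact: open_interior].
have bO : open_bisection O by apply: open_bisectionW bU oO _ => c [].
have [_ [c [Uc Sc] <-] triv] := trivial_isotropy_dense R G_second_countable
  G_locally_compact G_etale G_units_hausdorff G_effective (bisection_src_open bO)
  (ex_intro _ _ (ex_intro2 _ _ c0 (conj Uc0 c0S) erefl)).
(* The inverse bisection is the one to use: left multiplication by [ginv c] is what takes [c] to the
   unit at its source. *)
have bV := gsetV_bisection bO.
have Vc : gsetV O (ginv c) by rewrite /gsetV /= ginvK.
have [g gV gc] := bisection_bump R G_locally_compact G_units_hausdorff bV Vc.
have [b gb] := CG_regular_rep (CG_Cc bV gV).
have bC : Cr b by apply: regular_rep_Cr gb; exact: CG_Cc gV.
have rbx : rho (opfamM b x) = 0.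
  by rewrite (shM hrho bC xC) rx cmulr0.
have := jmap_unit_eq0 G_locally_compact G_units_hausdorff G_effective rho_hom
  rho_inj triv (ccM cC bC xC) rbx.
rewrite (jmap_translate _ bV gV Vc gc gb) => xc0.
by have := interior_subset Sc; rewrite /supp /= xc0 eqxx.
Qed.
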